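(* Let $(\mathbf{x}(t),\mathbf{y}(t))$, $\mathbf{v}=\mathbf{x}-\mathbf{y}$, be a bicycling geodesic in $\mathbb{R}^3$ with non-planar front track $\mathbf{x}(t)$, parametrized by arc length, whose curvature is $T$-periodic or $T$-antiperiodic, where $T$ is the period of $\kappa^2$, and with monodromy $M$. Let $\tilde{\mathbf{x}}(t)=\mathbf{x}(t)-2\mathbf{v}(t)$ be the front track of the geodesic obtained from it by bicycle correspondence. Then there is a screw motion $I$, with the same axis as $M$, such that (a) $\tilde{\mathbf{x}}(t+T/2)=I(\mathbf{x}(t))$ and $\mathbf{y}(t+T/2)=I(\mathbf{y}(t))$ for all $t$; (b) $I^2=M$.
   Context: A bicycle path in $\mathbb{R}^3$ is a pair of curves $(\mathbf{x}(t),\mathbf{y}(t))$ (front and back tracks) such that $\mathbf{v}:=\mathbf{x}-\mathbf{y}$ satisfies $|\mathbf{v}|=1$ and $\mathbf{y}'\parallel\mathbf{v}$ for all $t$. A bicycling geodesic is a bicycle path whose length (length of the front track) between any two of its placements is critical among bicycle paths connecting these placements. Bicycle correspondence is the map $\Phi(\mathbf{x},\mathbf{v})=(\mathbf{x}-2\mathbf{v},-\mathbf{v})$, which takes bicycling geodesics to bicycling geodesics and leaves the back track $\mathbf{y}$ unchanged. The curvature $\kappa$ and torsion of the front track are those of an analytic Frenet-Serret frame ($\mathbf{T}'=\kappa\mathbf{N}$, $\mathbf{N}'=-\kappa\mathbf{T}+\tau\mathbf{B}$, $\mathbf{B}'=-\tau\mathbf{N}$), so $\kappa$ may change sign at inflection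 points; $T$-antiperiodic means $\kappa(t+T)=-\kappa(t)$. The monodromy $M$ of such a geodesic is the unique orientation preserving isometry of $\mathbb{R}^3$ with $\mathbf{x}(t+T)=M(\mathbf{x}(t))$, $\mathbf{y}(t+T)=M(\mathbf{y}(t))$ for all $t\in\mathbb{R}$. A screw motion is an orientation preserving isometry of $\mathbb{R}^3$ that is the composition of a rotation about a line (its axis) and a translation along that line; every orientation preserving isometry of $\mathbb{R}^3$ is of this form. *)

(* Defs.v *)
From Stdlib Require Import Reals Lra.
From Coquelicot Require Import Coquelicot.
Open Scope R_scope.

(* Vector operations ([plus], [minus], [opp], [scal], [zero]), the norm and
   [is_derive] on [R3] are Coquelicot's, through its product structures. *)
Notation R3 := (R * R * R)%type.

Definition px (p : R3) : R := fst (fst p).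
Definition py (p : R3) : R := snd (fst p).
Definition pz (p : R3) : R := snd p.

Definition dot (p q : R3) : R := px p * px q + py p * py q + pz p * pz q.

Definition cross (p q : R3) : R3 :=
  (py p * pz q - pz p * py q,
   pz p * px q - px p * pz q,
   px p * py q - py p * px q).

(* Coquelicot's product norm is the Euclidean one, not the sup norm. *)
Lemma norm_R3 (p : R3) : norm p = sqrt (dot p p).
Proof.
destruct p as [[a b] c].
unfold norm; simpl; unfold prod_norm; simpl.
unfold norm; simpl; unfold prod_norm; simpl.
unfold norm; simpl; unfold abs; simpl; unfold dot, px, py, pz; simpl.
f_equal.
assert (sq : forall r, Rabs r * Rabs r = r * r)
  by (intro r; rewrite <- Rabs_mult; apply Rabs_pos_eq, Rle_0_sqr).
rewrite !Rmult_1_r, !sq, sqrt_sqrt by nra.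
ring.
Qed.

Definition planar (x : R -> R3) : Prop :=
  exists (n : R3) (d : R), n <> zero /\ forall t, dot n (x t) = d.

(** * Curves, smoothness, length *)

Definition smooth_curve (x : R -> R3) : Prop :=
  forall (k : nat) (t : R),
    ex_derive_n (fun u => px (x u)) k t /\
    ex_derive_n (fun u => py (x u)) k t /\
    ex_derive_n (fun u => pz (x u)) k t.

(* Joint smoothness in (s, t) on the strip |s| < eps. *)
Definition smooth_family (eps : R) (X : R -> R -> R3) : Prop :=
  forall (k : nat) (s t : R), Rabs s < eps ->
    ex_diff_n (fun u w => px (X u w)) k s t /\
    ex_diff_n (fun u w => py (X u w)) k s t /\
    ex_diff_n (fun u w => pz (X u w)) k s t.

Definition velocity (x : R -> R3) (t : R) : R3 :=
  (Derive (fun u => px (x u)) t,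
   Derive (fun u => py (x u)) t,
   Derive (fun u => pz (x u)) t).

Definition curve_length (x : R -> R3) (a b : R) : R :=
  RInt (fun t => norm (velocity x t)) a b.

Definition arc_length_parametrized (x : R -> R3) : Prop :=
  forall t, norm (velocity x t) = 1.

(** * Bicycle paths and bicycling geodesics *)

(* [x] is the front track and [y] the back track. The factor [c] is the signed
   speed of the back wheel; it may vanish, where the back track has a cusp. *)
Definition bicycle_path (x y : R -> R3) : Prop :=
  smooth_curve x /\ smooth_curve y /\
  (forall t, norm (minus (x t) (y t)) = 1) /\
  (forall t, exists c : R,
     is_derive y t (scal c (minus (x t) (y t)))).

(* One-parameter deformation of the path segment over [a, b] through bicycle
   paths connecting the same two placements. All paths are taken defined for
   every t, but only their restrictions to [a, b] matter. *)
Definition bicycle_variation (x y : R -> R3) (a b eps : R)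
    (X Y : R -> R -> R3) : Prop :=
  0 < eps /\
  smooth_family eps X /\ smooth_family eps Y /\
  (forall s, Rabs s < eps -> bicycle_path (X s) (Y s)) /\
  (forall t, a <= t <= b -> X 0 t = x t /\ Y 0 t = y t) /\
  (forall s, Rabs s < eps ->
     X s a = x a /\ Y s a = y a /\ X s b = x b /\ Y s b = y b).

Definition bicycling_geodesic (x y : R -> R3) : Prop :=
  bicycle_path x y /\
  forall a b : R, a < b ->
  forall (eps : R) (X Y : R -> R -> R3),
    bicycle_variation x y a b eps X Y ->
    is_derive (fun s => curve_length (X s) a b) 0 0.

(* Acts on pairs (x, v), where v is the frame vector from the back to the
   front wheel. *)
Definition bicycle_correspondence (q : R3 * R3) : R3 * R3 :=
  (minus (fst q) (scal 2 (snd q)), opp (snd q)).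

(** * Curvature *)

Definition analytic (f : R -> R) : Prop :=
  forall t0 : R, exists (a : nat -> R) (r : R), 0 < r /\
    forall t, Rabs (t - t0) < r -> is_pseries a (t - t0) (f t).

Definition analytic_curve (x : R -> R3) : Prop :=
  analytic (fun t => px (x t)) /\
  analytic (fun t => py (x t)) /\
  analytic (fun t => pz (x t)).

(* Analytic Frenet-Serret frame of a curve [x] parametrized by arc length;
   [kappa] is signed, and may vanish and change sign. *)
Definition frenet_frame (x Tn N B : R -> R3) (kappa tau : R -> R) : Prop :=
  analytic_curve Tn /\ analytic_curve N /\ analytic_curve B /\
  analytic kappa /\ analytic tau /\
  forall t,
    is_derive x t (Tn t) /\
    norm (Tn t) = 1 /\ norm (N t) = 1 /\ dot (Tn t) (N t) = 0 /\
    B t = cross (Tn t) (N t) /\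
    is_derive Tn t (scal (kappa t) (N t)) /\
    is_derive N t (plus (scal (- kappa t) (Tn t)) (scal (tau t) (B t))) /\
    is_derive B t (scal (- tau t) (N t)).

Definition is_curvature (x : R -> R3) (kappa : R -> R) : Prop :=
  exists (Tn N B : R -> R3) (tau : R -> R), frenet_frame x Tn N B kappa tau.

Definition periodic (T : R) (f : R -> R) : Prop := forall t, f (t + T) = f t.

Definition antiperiodic (T : R) (f : R -> R) : Prop :=
  forall t, f (t + T) = - f t.

(* The period is the least positive one; in particular [f] is not constant. *)
Definition is_period (T : R) (f : R -> R) : Prop :=
  0 < T /\ periodic T f /\ forall S, 0 < S -> periodic S f -> T <= S.

(** * Rigid motions *)

Definition isometry (M : R3 -> R3) : Prop :=
  forall p q, norm (minus (M p) (M q)) = norm (minus p q).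

(* Signed volume of the parallelepiped spanned at p0. *)
Definition volume (p0 p1 p2 p3 : R3) : R :=
  dot (cross (minus p1 p0) (minus p2 p0)) (minus p3 p0).

Definition orientation_preserving (M : R3 -> R3) : Prop :=
  forall p0 p1 p2 p3,
    0 < volume p0 p1 p2 p3 -> 0 < volume (M p0) (M p1) (M p2) (M p3).

Definition is_monodromy (x y : R -> R3) (T : R) (M : R3 -> R3) : Prop :=
  isometry M /\ orientation_preserving M /\
  forall t, x (t + T) = M (x t) /\ y (t + T) = M (y t).

(* Rotation by the angle [theta] about the line through [c] with unit
   direction [e] (Rodrigues' formula). *)
Definition rotation (c e : R3) (theta : R) (p : R3) : R3 :=
  let w := minus p c in
  plus c
    (plus (scal (cos theta) w)
       (plus (scal (sin theta) (cross e w))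
             (scal ((1 - cos theta) * dot e w) e))).

(* [M] is a screw motion having the line through [c] with direction [e] as an
   axis. The axis is unique unless the rotation part is trivial, in which case
   every line parallel to the translation (every line, for the identity) is
   an axis. *)
Definition screw_motion_about (c e : R3) (M : R3 -> R3) : Prop :=
  norm e = 1 /\
  exists theta h : R, forall p, M p = plus (rotation c e theta p) (scal h e).

(* Main.v *)
Require Import Defs.
From Stdlib Require Import Reals Lra Lia ZArith Classical.
From Coquelicot Require Import Coquelicot.
Open Scope R_scope.

(** Let v = x - y be the frame and write y' = c v. A bicycle path is the same
    thing as a curve v on the unit sphere, a function c and a starting point
    y(a); placing the back wheel correctly at the end is the single vector
    condition on the integral of c v, which is linear in c. Deformations with
    fixed end placements can therefore be written down by formulas: deform v
    and c, then restore the integral by solving a 3 x 3 linear system, which is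
    regular because v is not confined to a plane through the origin
    ([closing_correction]). Since |x'|^2 = c^2 + |v'|^2, criticality of the
    length yields a constant vector A with
      c = A.v   and   v'' = (2 c^2 - 1) v - c A      ([geodesic_equation]).

    Put w = A.v, which is also the signed speed c of the back wheel. Then
    w'' = 2 w^3 - (1 + |A|^2) w, and kappa^2 = k0 - 2 (w' + w^2) for a constant
    k0 ([curvature_sq]). The equation for w is invariant under w -> -w and
    under time reversal, so a solution is odd about each of its zeros and even
    about each of its critical points. Composing the two reflections gives a
    translation that negates w, and minimality of the period T of kappa^2
    forces w(t + T/2) = - w(t) ([half_period]).

    Consequently v(t) and -v(t + T/2) satisfy the same linear equation and
    have the same inner product with A. They also have the same length and,
    since the angular momentum of v about A is conserved, the same angular
    momentum. At one instant this makes their positions and velocities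
    correspond under a rotation about the direction of A, hence at every
    instant ([frame_half_period_rotation]). Integrating y' = w v, in which both
    factors change sign, extends the correspondence to the back track:
    y(t + T/2) = J(y(t)) for an isometry J with that rotation as linear part.
    Then J carries x(t) to x~(t + T/2) and x~(t) to x(t + T/2), so J o J agrees
    with M on the front track, and two isometries that agree on a non-planar
    curve are equal ([isometries_agree]). Finally J is a screw motion
    ([turn_translation_screw]), and its square is a screw motion about the
    same axis ([screw_motion_square]). *)

(** * Smooth functions and smooth one-parameter families *)

(** Partial derivatives are supplied as witnesses instead of being computed by
    [Derive]: closure under sums, products and inverses is then a plain
    induction on k. *)
Fixpoint smooth_upto (eps : R) (k : nat) (f : R -> R -> R) : Prop :=
  (forall s t, Rabs s < eps -> continuity_2d_pt f s t) /\
  match k with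
  | O => True
  | S k => exists fs ft, smooth_upto eps k fs /\ smooth_upto eps k ft /\
      forall s t, Rabs s < eps ->
        is_derive (fun u => f u t) s (fs s t) /\
        is_derive (fun w => f s w) t (ft s t)
  end.

Definition strip_smooth (eps : R) (f : R -> R -> R) : Prop :=
  forall k, smooth_upto eps k f.

Definition smooth (g : R -> R) : Prop := forall k t, ex_derive_n g k t.

Lemma strip_locally_2d eps (P : R -> R -> Prop) :
  (forall s t, Rabs s < eps -> P s t) ->
  forall s t, Rabs s < eps -> locally_2d P s t.
Proof.
intros HP s t Hs.
assert (Hd : 0 < eps - Rabs s) by lra.
exists (mkposreal _ Hd); simpl; intros u w Hu _; apply HP.
pose proof (Rabs_triang (u - s) s).
replace (u - s + s) with u in H by ring; lra.
Qed.

Lemma strip_locally eps (P : R -> Prop) :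
  (forall s, Rabs s < eps -> P s) -> forall s, Rabs s < eps -> locally s P.
Proof.
intros HP s Hs.
assert (Hd : 0 < eps - Rabs s) by lra.
exists (mkposreal _ Hd); simpl; intros u Hu; apply HP.
unfold ball in Hu; simpl in Hu; unfold AbsRing_ball, abs, minus, plus, opp in Hu; simpl in Hu.
pose proof (Rabs_triang (u + - s) s).
replace (u + - s + s) with u in H by ring; lra.
Qed.

Lemma smooth_upto_continuous eps k f :
  smooth_upto eps k f -> forall s t, Rabs s < eps -> continuity_2d_pt f s t.
Proof. destruct k; intros [H _]; exact H. Qed.

Lemma smooth_upto_pred eps k f : smooth_upto eps (S k) f -> smooth_upto eps k f.
Proof.
revert f; induction k as [|k IH]; intros f [Hc [fs [ft [Hs [Ht H]]]]].
- split; auto.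
- split; [exact Hc|]. exists fs, ft. auto.
Qed.

Lemma smooth_upto_ext eps k f g :
  (forall s t, Rabs s < eps -> f s t = g s t) ->
  smooth_upto eps k f -> smooth_upto eps k g.
Proof.
intros E Hf.
assert (Hc : forall s t, Rabs s < eps -> continuity_2d_pt g s t).
{ intros s t Hs; apply continuity_2d_pt_ext_loc with f.
  - now apply strip_locally_2d with eps.
  - eapply smooth_upto_continuous; eauto. }
destruct k as [|k]; [now split|].
destruct Hf as [_ [fs [ft [Hs [Ht H]]]]].
split; [exact Hc|].
exists fs, ft; split; [exact Hs|split; [exact Ht|]].
intros s t Hst; destruct (H s t Hst) as [H1 H2]; split.
- apply is_derive_ext_loc with (fun u => f u t); [|exact H1].
  apply strip_locally with eps; auto.
- apply is_derive_ext with (fun w => f s w); auto.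
Qed.

Lemma smooth_upto_plus eps k f g :
  smooth_upto eps k f -> smooth_upto eps k g ->
  smooth_upto eps k (fun s t => f s t + g s t).
Proof.
revert f g; induction k as [|k IH]; intros f g Hf Hg; (split;
  [intros; apply continuity_2d_pt_plus; eapply smooth_upto_continuous; eauto|]); auto.
destruct Hf as [_ [fs [ft [Hfs [Hft Hf]]]]].
destruct Hg as [_ [gs [gt [Hgs [Hgt Hg]]]]].
exists (fun s t => fs s t + gs s t), (fun s t => ft s t + gt s t).
split; [auto|split; [auto|]]; intros s t Hst.
destruct (Hf s t Hst), (Hg s t Hst).
split; now apply @is_derive_plus.
Qed.

Lemma smooth_upto_mult eps k f g :
  smooth_upto eps k f -> smooth_upto eps k g ->
  smooth_upto eps k (fun s t => f s t * g s t).
Proof.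
revert f g; induction k as [|k IH]; intros f g Hf Hg; (split;
  [intros; apply continuity_2d_pt_mult; eapply smooth_upto_continuous; eauto|]); auto.
pose proof (smooth_upto_pred _ _ _ Hf) as Hf0.
pose proof (smooth_upto_pred _ _ _ Hg) as Hg0.
destruct Hf as [_ [fs [ft [Hfs [Hft Hf]]]]].
destruct Hg as [_ [gs [gt [Hgs [Hgt Hg]]]]].
exists (fun s t => fs s t * g s t + f s t * gs s t),
  (fun s t => ft s t * g s t + f s t * gt s t).
split; [auto using smooth_upto_plus|split; [auto using smooth_upto_plus|]].
intros s t Hst; destruct (Hf s t Hst), (Hg s t Hst).
split.
- apply (is_derive_mult (fun u => f u t) (fun u => g u t)); auto;
    intros; apply Rmult_comm.
- apply (is_derive_mult (fun w => f s w) (fun w => g s w)); auto;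
    intros; apply Rmult_comm.
Qed.

Lemma smooth_upto_const eps k c : smooth_upto eps k (fun _ _ => c).
Proof.
revert c; induction k as [|k IH]; intros c;
  (split; [intros; apply continuity_2d_pt_const|]); auto.
exists (fun _ _ => 0), (fun _ _ => 0).
split; [auto|split; [auto|]]; intros; split; apply @is_derive_const.
Qed.

Lemma smooth_upto_inv eps k f :
  (forall s t, Rabs s < eps -> f s t <> 0) ->
  smooth_upto eps k f -> smooth_upto eps k (fun s t => / f s t).
Proof.
intro Hnz; induction k as [|k IH]; intros Hf; (split;
  [intros; apply continuity_2d_pt_inv;
   [eapply smooth_upto_continuous; eauto|auto]|]); auto.
pose proof (IH (smooth_upto_pred _ _ _ Hf)) as Hi.
destruct Hf as [_ [fs [ft [Hfs [Hft Hf]]]]].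
exists (fun s t => (-1) * fs s t * (/ f s t * / f s t)),
  (fun s t => (-1) * ft s t * (/ f s t * / f s t)).
split; [auto using smooth_upto_mult, smooth_upto_const|].
split; [auto using smooth_upto_mult, smooth_upto_const|].
intros s t Hst; destruct (Hf s t Hst); split.
- replace (-1 * fs s t * (/ f s t * / f s t)) with (- fs s t / (f s t) ^ 2)
    by (field; auto).
  apply (is_derive_inv (fun u => f u t)); auto.
- replace (-1 * ft s t * (/ f s t * / f s t)) with (- ft s t / (f s t) ^ 2)
    by (field; auto).
  apply (is_derive_inv (fun w => f s w)); auto.
Qed.

Lemma strip_smooth_ext eps f g :
  (forall s t, Rabs s < eps -> f s t = g s t) ->
  strip_smooth eps f -> strip_smooth eps g.
Proof. intros E H k; now apply smooth_upto_ext with f. Qed.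

Lemma strip_smooth_const eps c : strip_smooth eps (fun _ _ => c).
Proof. intro k; apply smooth_upto_const. Qed.

Lemma strip_smooth_plus eps f g :
  strip_smooth eps f -> strip_smooth eps g ->
  strip_smooth eps (fun s t => f s t + g s t).
Proof. intros Hf Hg k; now apply smooth_upto_plus. Qed.

Lemma strip_smooth_mult eps f g :
  strip_smooth eps f -> strip_smooth eps g ->
  strip_smooth eps (fun s t => f s t * g s t).
Proof. intros Hf Hg k; now apply smooth_upto_mult. Qed.

Lemma strip_smooth_inv eps f :
  (forall s t, Rabs s < eps -> f s t <> 0) ->
  strip_smooth eps f -> strip_smooth eps (fun s t => / f s t).
Proof. intros Hn Hf k; now apply smooth_upto_inv. Qed.

Lemma strip_smooth_opp eps f :
  strip_smooth eps f -> strip_smooth eps (fun s t => - f s t).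
Proof.
intro Hf; apply strip_smooth_ext with (fun s t => (-1) * f s t).
- intros; ring.
- now apply strip_smooth_mult; [apply strip_smooth_const|].
Qed.

Lemma strip_smooth_minus eps f g :
  strip_smooth eps f -> strip_smooth eps g ->
  strip_smooth eps (fun s t => f s t - g s t).
Proof. intros; apply strip_smooth_plus; auto using strip_smooth_opp. Qed.

Lemma strip_smooth_div eps f g :
  (forall s t, Rabs s < eps -> g s t <> 0) ->
  strip_smooth eps f -> strip_smooth eps g ->
  strip_smooth eps (fun s t => f s t / g s t).
Proof. intros; apply strip_smooth_mult; auto using strip_smooth_inv. Qed.

Lemma strip_smooth_pow eps f n :
  strip_smooth eps f -> strip_smooth eps (fun s t => f s t ^ n).
Proof.
intro Hf; induction n as [|n IH]; simpl;
  auto using strip_smooth_const, strip_smooth_mult.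
Qed.

Lemma strip_smooth_param eps : strip_smooth eps (fun s _ => s).
Proof.
intros [|k]; (split; [intros; apply continuity_2d_pt_id1|]); auto.
exists (fun _ _ => 1), (fun _ _ => 0).
split; [apply smooth_upto_const|split; [apply smooth_upto_const|]].
intros; split.
- apply @is_derive_id.
- apply @is_derive_const.
Qed.

Lemma strip_smooth_derives eps f :
  strip_smooth eps f ->
  strip_smooth eps (fun s t => Derive (fun u => f u t) s) /\
  strip_smooth eps (fun s t => Derive (fun w => f s w) t) /\
  forall s t, Rabs s < eps ->
    is_derive (fun u => f u t) s (Derive (fun u => f u t) s) /\
    is_derive (fun w => f s w) t (Derive (fun w => f s w) t).
Proof.
intro Hf; split; [|split; [|intros s t Hst; split]].
- intro k; destruct (Hf (S k)) as [_ [fs [ft [Hs [_ H]]]]].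
  apply smooth_upto_ext with fs; [|exact Hs].
  intros s t Hst; symmetry; apply is_derive_unique, H, Hst.
- intro k; destruct (Hf (S k)) as [_ [fs [ft [_ [Ht H]]]]].
  apply smooth_upto_ext with ft; [|exact Ht].
  intros s t Hst; symmetry; apply is_derive_unique, H, Hst.
- destruct (Hf 1%nat) as [_ [fs [ft [_ [_ H']]]]].
  apply Derive_correct; exists (fs s t); apply H'; auto.
- destruct (Hf 1%nat) as [_ [fs [ft [_ [_ H']]]]].
  apply Derive_correct; exists (ft s t); apply H'; auto.
Qed.

Lemma strip_smooth_ex_diff_n eps f :
  strip_smooth eps f ->
  forall k s t, Rabs s < eps -> ex_diff_n f k s t.
Proof.
intros Hf k; revert f Hf; induction k as [|k IH]; intros f Hf s t Hs; simpl;
  (split; [exact (smooth_upto_continuous _ _ _ (Hf O) s t Hs)|]); auto.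
destruct (strip_smooth_derives _ _ Hf) as [H1 [H2 H3]].
destruct (H3 s t Hs); split; [eexists; eassumption|].
split; [eexists; eassumption|split; now apply IH].
Qed.

Lemma Derive_n_Derive f n t : Derive_n (Derive f) n t = Derive_n f (S n) t.
Proof.
replace (S n) with (n + 1)%nat by lia.
exact (Derive_n_comp f n 1 t).
Qed.

Lemma ex_derive_n_Derive f n t :
  ex_derive_n f (S (S n)) t <-> ex_derive_n (Derive f) (S n) t.
Proof.
split; apply ex_derive_ext; intro u; rewrite Derive_n_Derive; reflexivity.
Qed.

Lemma smooth_intro g :
  (forall t, ex_derive g t) -> smooth (Derive g) -> smooth g.
Proof.
intros H1 H2 [|[|k]] t.
- exact I.
- exact (H1 t).
- exact (proj2 (ex_derive_n_Derive g k t) (H2 _ t)).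
Qed.

Lemma smooth_Derive g : smooth g -> smooth (Derive g).
Proof.
intros H [|k] t; [exact I|]. exact (proj1 (ex_derive_n_Derive g k t) (H _ t)).
Qed.

Lemma smooth_is_derive g t : smooth g -> is_derive g t (Derive g t).
Proof. intro H; apply Derive_correct, (H 1%nat). Qed.

Lemma smooth_continuous g t : smooth g -> continuous g t.
Proof. intro H; apply @ex_derive_continuous, (H 1%nat). Qed.

Lemma strip_smooth_time eps g : smooth g -> strip_smooth eps (fun _ t => g t).
Proof.
intros Hg k; revert g Hg; induction k as [|k IH]; intros g Hg;
  (split; [intros s t _; apply continuity_1d_2d_pt_comp with (g := fun _ t => t);
     [apply continuity_pt_filterlim, smooth_continuous, Hg
     |apply continuity_2d_pt_id2]|]); auto.
exists (fun _ _ => 0), (fun _ t => Derive g t).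
split; [apply smooth_upto_const|split; [apply IH, smooth_Derive, Hg|]].
intros; split.
- apply @is_derive_const.
- apply smooth_is_derive, Hg.
Qed.

Lemma smooth_strip_slice eps f s :
  strip_smooth eps f -> Rabs s < eps -> smooth (f s).
Proof.
intros Hf Hs k; revert f Hf; induction k as [|[|k] IH]; intros f Hf t;
  [exact I| |];
  destruct (strip_smooth_derives _ _ Hf) as [_ [H2 H3]].
- destruct (H3 s t Hs) as [_ H]; eexists; exact H.
- apply (proj2 (ex_derive_n_Derive (f s) k t)).
  apply (IH (fun s t => Derive (fun w => f s w) t) H2).
Qed.

(** Smooth functions of t are the families that do not depend on s, so the
    closure properties below are inherited from those of families. *)
Lemma smooth_from_strip g : strip_smooth 1 (fun _ t => g t) -> smooth g.
Proof.
intro H; apply (smooth_strip_slice 1 (fun _ t => g t) 0 H).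
rewrite Rabs_R0; lra.
Qed.

Lemma smooth_ext f g : (forall t, f t = g t) -> smooth f -> smooth g.
Proof.
intros E Hf; apply smooth_from_strip.
apply strip_smooth_ext with (fun _ t => f t); auto using strip_smooth_time.
Qed.

Lemma smooth_const c : smooth (fun _ => c).
Proof. apply smooth_from_strip, strip_smooth_const. Qed.

Lemma smooth_id : smooth (fun t => t).
Proof.
apply smooth_intro.
- intro t; apply ex_derive_id.
- apply smooth_ext with (fun _ => 1); [|apply smooth_const].
  intro t; symmetry; apply Derive_id.
Qed.

Lemma smooth_plus f g : smooth f -> smooth g -> smooth (fun t => f t + g t).
Proof.
intros; apply smooth_from_strip, strip_smooth_plus; now apply strip_smooth_time.
Qed.

Lemma smooth_mult f g : smooth f -> smooth g -> smooth (fun t => f t * g t).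
Proof.
intros; apply smooth_from_strip, strip_smooth_mult; now apply strip_smooth_time.
Qed.

Lemma smooth_minus f g : smooth f -> smooth g -> smooth (fun t => f t - g t).
Proof.
intros; apply smooth_from_strip, strip_smooth_minus; now apply strip_smooth_time.
Qed.

Lemma smooth_pow f n : smooth f -> smooth (fun t => f t ^ n).
Proof.
intros; apply smooth_from_strip, (strip_smooth_pow 1 (fun _ t => f t)).
now apply strip_smooth_time.
Qed.

(** * Integrals of smooth functions *)

Lemma smooth_ex_RInt g a b : smooth g -> ex_RInt g a b.
Proof.
intro Hg; apply @ex_RInt_continuous; intros; now apply smooth_continuous.
Qed.

Lemma smooth_is_derive_RInt g a t :
  smooth g -> is_derive (fun t => RInt g a t) t (g t).
Proof.
intro Hg; apply is_derive_RInt with a.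
- apply filter_forall; intro u; apply @RInt_correct, smooth_ex_RInt, Hg.
- apply smooth_continuous, Hg.
Qed.

Lemma smooth_RInt g a : smooth g -> smooth (fun t => RInt g a t).
Proof.
intro Hg; apply smooth_intro.
- intro t; eexists; now apply smooth_is_derive_RInt.
- apply smooth_ext with g; [|exact Hg].
  intro t; symmetry; apply is_derive_unique; now apply smooth_is_derive_RInt.
Qed.

(** Leibniz's rule; joint smoothness provides the uniformity in t. *)
Lemma is_derive_RInt_strip eps f a b :
  0 < eps -> strip_smooth eps f ->
  is_derive (fun s => RInt (f s) a b) 0
    (RInt (fun t => Derive (fun u => f u t) 0) a b).
Proof.
intros He Hf.
assert (H0 : Rabs 0 < eps) by (now rewrite Rabs_R0).
destruct (strip_smooth_derives _ _ Hf) as [H1 [_ H3]].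
apply is_derive_RInt_param.
- apply (strip_locally eps); [|exact H0].
  intros s Hs t _; destruct (H3 s t Hs) as [H _]; eexists; exact H.
- intros t _; exact (smooth_upto_continuous _ _ _ (H1 O) 0 t H0).
- apply (strip_locally eps); [|exact H0].
  intros s Hs; apply smooth_ex_RInt.
  now apply smooth_strip_slice with eps.
Qed.

Lemma constant_integral_derivative eps f a b k :
  0 < eps -> strip_smooth eps f ->
  (forall s, Rabs s < eps -> RInt (f s) a b = k) ->
  RInt (fun t => Derive (fun u => f u t) 0) a b = 0.
Proof.
intros He Hf Hk.
pose proof (is_derive_RInt_strip eps f a b He Hf) as H.
rewrite <- (is_derive_unique _ _ _ H).
rewrite (Derive_ext_loc _ (fun _ => k)); [apply Derive_const|].
apply (strip_locally eps); [exact Hk|now rewrite Rabs_R0].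
Qed.

Lemma RInt_derivative (f g : R -> R) a b :
  (forall t, is_derive f t (g t)) -> smooth g -> RInt g a b = f b - f a.
Proof.
intros Hd Hg; apply is_RInt_unique, (is_RInt_derive f g); intros t _;
  [apply Hd|now apply smooth_continuous].
Qed.

Lemma RInt_ext_everywhere (f g : R -> R) a b : (forall t, f t = g t) -> RInt f a b = RInt g a b.
Proof. intro H; apply RInt_ext; auto. Qed.

Lemma smooth_RInt_minus f g a b : smooth f -> smooth g ->
  RInt (fun t => f t - g t) a b = RInt f a b - RInt g a b.
Proof. intros Hf Hg; apply (RInt_minus f g); now apply smooth_ex_RInt. Qed.

Lemma smooth_RInt_scal k f a b : smooth f ->
  RInt (fun t => k * f t) a b = k * RInt f a b.
Proof. intro Hf; apply (RInt_scal f a b k); now apply smooth_ex_RInt. Qed.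

Lemma RInt_nonneg_zero f a b : a < b -> smooth f ->
  (forall t, a <= t <= b -> 0 <= f t) -> RInt f a b = 0 ->
  forall t, a < t < b -> f t = 0.
Proof.
intros Hab Hf Hpos H0 t Ht.
assert (Hz : forall u, a < u < b -> RInt f a u = 0).
{ intros u Hu.
  assert (H1 : 0 <= RInt f a u).
  { apply RInt_ge_0; [lra|now apply smooth_ex_RInt|intros; apply Hpos; lra]. }
  assert (H2 : 0 <= RInt f u b).
  { apply RInt_ge_0; [lra|now apply smooth_ex_RInt|intros; apply Hpos; lra]. }
  pose proof (RInt_Chasles f a u b (smooth_ex_RInt _ _ _ Hf) (smooth_ex_RInt _ _ _ Hf))
    as H3.
  unfold plus in H3; simpl in H3; lra. }
rewrite <- (is_derive_unique _ _ _ (smooth_is_derive_RInt f a t Hf)).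
rewrite (Derive_ext_loc _ (fun _ => 0)); [apply Derive_const|].
apply (locally_interval _ t a b); simpl; try lra.
intros u H1 H2; apply Hz; split; assumption.
Qed.

Lemma is_derive_zero_const (f : R -> R) :
  (forall t, is_derive f t 0) -> forall s t, f s = f t.
Proof.
intros H s t.
destruct (MVT_gen f s t (fun _ => 0)) as [c [_ Hc]].
- intros; apply H.
- intros; apply continuity_pt_filterlim, @ex_derive_continuous.
  exists 0; apply H.
- lra.
Qed.

(** * Vector algebra in R^3 *)

Lemma px_plus p q : px (plus p q) = px p + px q. Proof. reflexivity. Qed.
Lemma py_plus p q : py (plus p q) = py p + py q. Proof. reflexivity. Qed.
Lemma pz_plus p q : pz (plus p q) = pz p + pz q. Proof. reflexivity. Qed.
Lemma px_opp p : px (opp p) = - px p. Proof. reflexivity. Qed.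
Lemma py_opp p : py (opp p) = - py p. Proof. reflexivity. Qed.
Lemma pz_opp p : pz (opp p) = - pz p. Proof. reflexivity. Qed.
Lemma px_minus p q : px (minus p q) = px p - px q. Proof. reflexivity. Qed.
Lemma py_minus p q : py (minus p q) = py p - py q. Proof. reflexivity. Qed.
Lemma pz_minus p q : pz (minus p q) = pz p - pz q. Proof. reflexivity. Qed.
Lemma px_scal (a : R) (p : R3) : px (scal a p) = a * px p. Proof. reflexivity. Qed.
Lemma py_scal (a : R) (p : R3) : py (scal a p) = a * py p. Proof. reflexivity. Qed.
Lemma pz_scal (a : R) (p : R3) : pz (scal a p) = a * pz p. Proof. reflexivity. Qed.
Lemma px_zero : px zero = 0. Proof. reflexivity. Qed.
Lemma py_zero : py zero = 0. Proof. reflexivity. Qed.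
Lemma pz_zero : pz zero = 0. Proof. reflexivity. Qed.
Lemma px_triple (a b c : R) : px (a, b, c) = a. Proof. reflexivity. Qed.
Lemma py_triple (a b c : R) : py (a, b, c) = b. Proof. reflexivity. Qed.
Lemma pz_triple (a b c : R) : pz (a, b, c) = c. Proof. reflexivity. Qed.

Global Hint Rewrite px_plus py_plus pz_plus px_opp py_opp pz_opp px_minus py_minus
  pz_minus px_scal py_scal pz_scal px_zero py_zero pz_zero px_triple
  py_triple pz_triple : coords.

Ltac coords :=
  unfold dot, cross; autorewrite with coords;
  repeat match goal with
  | |- context [px (@zero ?G)] => change (px (@zero G)) with 0
  | |- context [py (@zero ?G)] => change (py (@zero G)) with 0
  | |- context [pz (@zero ?G)] => change (pz (@zero G)) with 0
  end.

Lemma R3_ext p q : px p = px q -> py p = py q -> pz p = pz q -> p = q.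
Proof.
destruct p as [[a b] c], q as [[d e] f]; unfold px, py, pz; simpl.
congruence.
Qed.

(** An equation between module operations may be stated in a carrier that only
    computes to [R]; [ring] and [field] look for [R] itself. *)
Ltac R_eq := match goal with |- @eq _ ?a ?b => change (@eq R a b) end.

Ltac r3_ring := try apply R3_ext; coords; R_eq; ring.

Lemma dot_comm p q : dot p q = dot q p.
Proof. r3_ring. Qed.

Lemma dot_plus_l p q r : dot (plus p q) r = dot p r + dot q r.
Proof. r3_ring. Qed.

Lemma dot_plus_r p q r : dot r (plus p q) = dot r p + dot r q.
Proof. r3_ring. Qed.

Lemma dot_minus_l p q r : dot (minus p q) r = dot p r - dot q r.
Proof. r3_ring. Qed.

Lemma dot_minus_r p q r : dot r (minus p q) = dot r p - dot r q.
Proof. r3_ring. Qed.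

Lemma dot_scal_l (a : R) p r : dot (scal a p) r = a * dot p r.
Proof. r3_ring. Qed.

Lemma dot_scal_r (a : R) p r : dot r (scal a p) = a * dot r p.
Proof. r3_ring. Qed.

Lemma dot_zero_l p : dot zero p = 0.
Proof. r3_ring. Qed.

Lemma dot_zero_r p : dot p zero = 0.
Proof. r3_ring. Qed.

Lemma dot_self_pos p : 0 <= dot p p.
Proof.
unfold dot.
pose proof (Rle_0_sqr (px p)); pose proof (Rle_0_sqr (py p));
  pose proof (Rle_0_sqr (pz p)); unfold Rsqr in *; lra.
Qed.

Lemma dot_self_zero p : dot p p = 0 -> p = zero.
Proof.
unfold dot; intro H.
apply R3_ext; coords; nra.
Qed.

Lemma dot_all_zero p : (forall n, dot n p = 0) -> p = zero.
Proof. intro H; apply dot_self_zero, H. Qed.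

Lemma R3_ext_dot p q : (forall n, dot n p = dot n q) -> p = q.
Proof.
intro H; pose proof (H (1, 0, 0)) as H1; pose proof (H (0, 1, 0)) as H2;
  pose proof (H (0, 0, 1)) as H3; revert H1 H2 H3; coords; intros.
apply R3_ext; lra.
Qed.

Lemma norm_one p : norm p = 1 <-> dot p p = 1.
Proof.
rewrite norm_R3; split; intro H.
- rewrite <- (sqrt_sqrt (dot p p)), H; [lra|apply dot_self_pos].
- rewrite H; apply sqrt_1.
Qed.

Lemma normalize_unit p : p <> zero ->
  exists (k : R) (e : R3), dot e e = 1 /\ p = scal k e.
Proof.
intro Hp.
assert (Hpp : 0 < dot p p).
{ destruct (dot_self_pos p) as [H|H]; [exact H|].
  exfalso; apply Hp, dot_self_zero; now symmetry. }
pose proof (sqrt_lt_R0 _ Hpp) as Hk; pose proof (sqrt_sqrt (dot p p) (Rlt_le _ _ Hpp)) as Hk2.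
set (k := sqrt (dot p p)) in *.
exists k, (scal (/ k) p); split.
- rewrite dot_scal_l, dot_scal_r, <- Hk2; field; lra.
- apply R3_ext; autorewrite with coords; field; lra.
Qed.

Definition det (p q r : R3) : R := dot p (cross q r).

(** Cramer's rule: unlike an abstract inverse, this solution visibly depends
    smoothly on the columns and on the right-hand side. *)
Definition cramer (g1 g2 g3 r : R3) : R3 :=
  (det r g2 g3 / det g1 g2 g3, det g1 r g3 / det g1 g2 g3,
   det g1 g2 r / det g1 g2 g3).

Lemma cramer_solves g1 g2 g3 r : det g1 g2 g3 <> 0 ->
  let l := cramer g1 g2 g3 r in
  plus (plus (scal (px l) g1) (scal (py l) g2)) (scal (pz l) g3) = r.
Proof.
intros H l; unfold l, cramer; apply R3_ext; autorewrite with coords;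
  (field_simplify_eq; [|exact H]); unfold det, dot, cross;
  autorewrite with coords; ring.
Qed.

Lemma cramer_zero g1 g2 g3 : cramer g1 g2 g3 zero = zero.
Proof.
unfold cramer, det; apply R3_ext; coords; unfold Rdiv; R_eq; ring.
Qed.

Lemma nonzero_perp p : exists n : R3, n <> zero /\ dot n p = 0.
Proof.
destruct (Req_dec (px p) 0) as [H|H].
- exists (1, 0, 0); split.
  + intro E; apply (f_equal px) in E; revert E; coords; lra.
  + coords; rewrite H; ring.
- exists (py p, - px p, 0); split.
  + intro E; apply (f_equal py) in E; revert E; coords; lra.
  + coords; ring.
Qed.

(** By Lagrange's identity |p|^2 (n.q) = (p.q)(n.p) + (p x q).(p x n). *)
Lemma cross_zero_perp p q n :
  p <> zero -> cross p q = zero -> dot n p = 0 -> dot n q = 0.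
Proof.
intros Hp Hc Hn.
assert (H : dot p p * dot n q = dot p q * dot n p + dot (cross p q) (cross p n))
  by r3_ring.
rewrite Hn, Hc, dot_zero_l in H.
assert (Hpp : dot p p <> 0) by (intro E; apply Hp, dot_self_zero, E).
apply Rmult_eq_reg_l with (dot p p); [|exact Hpp]; lra.
Qed.

Lemma det_zero_perp p q r : det p q r = 0 ->
  exists n : R3, n <> zero /\ dot n p = 0 /\ dot n q = 0 /\ dot n r = 0.
Proof.
intro Hd.
destruct (classic (cross p q = zero)) as [Hpq|Hpq].
2:{ exists (cross p q); split; [exact Hpq|].
    assert (dot (cross p q) r = det p q r) by (unfold det; r3_ring).
    repeat split; [r3_ring|r3_ring|lra]. }
destruct (classic (p = zero)) as [->|Hp].
- destruct (classic (cross q r = zero)) as [Hqr|Hqr].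
  + destruct (classic (q = zero)) as [->|Hq].
    * destruct (nonzero_perp r) as [n [Hn Hr]]; exists n.
      rewrite !dot_zero_r; auto.
    * destruct (nonzero_perp q) as [n [Hn Hnq]]; exists n.
      rewrite dot_zero_r; repeat split; auto.
      now apply cross_zero_perp with q.
  + exists (cross q r); repeat split; try r3_ring; exact Hqr.
- destruct (classic (cross p r = zero)) as [Hpr|Hpr].
  + destruct (nonzero_perp p) as [n [Hn Hnp]]; exists n.
    repeat split; auto; now apply cross_zero_perp with p.
  + exists (cross p r); repeat split; try r3_ring; try exact Hpr.
    assert (dot (cross p r) q = - det p q r) by (unfold det; r3_ring); lra.
Qed.

Lemma perp_det_zero p q r n :
  det p q r <> 0 -> dot n p = 0 -> dot n q = 0 -> dot n r = 0 -> n = zero.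
Proof.
intros Hd Hp Hq Hr.
assert (E : scal (det p q r) n =
  plus (plus (scal (dot n p) (cross q r)) (scal (dot n q) (cross r p)))
    (scal (dot n r) (cross p q))) by (unfold det; r3_ring).
rewrite Hp, Hq, Hr in E.
assert (E0 : scal (det p q r) n = zero) by (rewrite E; r3_ring).
apply R3_ext; [apply (f_equal px) in E0|apply (f_equal py) in E0
  |apply (f_equal pz) in E0]; revert E0; autorewrite with coords; intro E0;
  apply Rmult_integral in E0; tauto.
Qed.

(** * Calculus of curves in R^3 *)

Local Notation R2_module := (prod_NormedModule _ R_NormedModule R_NormedModule).
Local Notation R3_module := (prod_NormedModule _ R2_module R_NormedModule).

Lemma is_derive_linear (L : R3 -> R) (f : R -> R3) t l :
  is_linear (L : R3_module -> R_NormedModule) ->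
  is_derive f t l -> is_derive (fun u => L (f u)) t (L l).
Proof.
intros HL Hf.
apply filterdiff_ext_lin with (fun u : R => L (scal u l)).
- apply (filterdiff_comp' f L t _ L Hf), filterdiff_linear, HL.
- intro u; apply (linear_scal L HL).
Qed.

Lemma is_derive_coords (f : R -> R3) t l :
  is_derive f t l <->
  is_derive (fun u => px (f u)) t (px l) /\
  is_derive (fun u => py (f u)) t (py l) /\
  is_derive (fun u => pz (f u)) t (pz l).
Proof.
split.
- intro H; split; [|split].
  + apply (is_derive_linear px); [|exact H].
    apply (is_linear_comp (U := R3_module) fst fst); apply is_linear_fst.
  + apply (is_derive_linear py); [|exact H].
    apply (is_linear_comp (U := R3_module) fst snd);
      [apply is_linear_fst|apply is_linear_snd].
  + apply (is_derive_linear pz); [|exact H].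
    apply (is_linear_snd (U := R2_module)).
- intros (H1 & H2 & H3).
  apply is_derive_ext with (fun u => plus (plus (scal (px (f u)) ((1,0,0) : R3))
    (scal (py (f u)) ((0,1,0) : R3))) (scal (pz (f u)) ((0,0,1) : R3))).
  { intro u; r3_ring. }
  replace l with (plus (plus (scal (px l) ((1,0,0) : R3))
    (scal (py l) ((0,1,0) : R3))) (scal (pz l) ((0,0,1) : R3))) by r3_ring.
  apply @is_derive_plus; [apply @is_derive_plus|]; now apply @is_derive_scal_l.
Qed.

Lemma velocity_unique (f : R -> R3) t l : is_derive f t l -> velocity f t = l.
Proof.
intro H; apply is_derive_coords in H; destruct H as (H1 & H2 & H3).
apply R3_ext; unfold velocity; coords; now apply is_derive_unique.
Qed.

Lemma is_derive_dot (f g : R -> R3) t df dg :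
  is_derive f t df -> is_derive g t dg ->
  is_derive (fun u => dot (f u) (g u)) t (dot df (g t) + dot (f t) dg).
Proof.
intros Hf Hg; apply is_derive_coords in Hf, Hg.
destruct Hf as (H1 & H2 & H3), Hg as (H4 & H5 & H6).
unfold dot.
replace (_ + _ + _ + _) with
  ((px df * px (g t) + px (f t) * px dg) + (py df * py (g t) + py (f t) * py dg)
   + (pz df * pz (g t) + pz (f t) * pz dg)) by ring.
apply @is_derive_plus; [apply @is_derive_plus|];
  [apply (is_derive_mult (fun u => px (f u)) (fun u => px (g u)))
  |apply (is_derive_mult (fun u => py (f u)) (fun u => py (g u)))
  |apply (is_derive_mult (fun u => pz (f u)) (fun u => pz (g u)))];
  auto; intros; apply Rmult_comm.
Qed.

Lemma is_derive_dot_const (n : R3) (f : R -> R3) t df :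
  is_derive f t df -> is_derive (fun u => dot n (f u)) t (dot n df).
Proof.
intro Hf; pose proof (is_derive_dot (fun _ => n) f t zero df (is_derive_const n t) Hf) as H.
cbv beta in H; rewrite dot_zero_l, Rplus_0_l in H; exact H.
Qed.

Lemma is_derive_cross (n : R3) (f : R -> R3) t df :
  is_derive f t df -> is_derive (fun u => cross n (f u)) t (cross n df).
Proof.
intro Hf; apply is_derive_coords in Hf; destruct Hf as (H1 & H2 & H3).
apply is_derive_coords; unfold cross, px, py, pz in *; cbn [fst snd].
split; [|split]; apply @is_derive_minus; apply is_derive_scal; assumption.
Qed.

Lemma is_derive_scal_R3 (g : R -> R) (f : R -> R3) t dg df :
  is_derive g t dg -> is_derive f t df ->
  is_derive (fun u => scal (g u) (f u)) t (plus (scal dg (f t)) (scal (g t) df)).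
Proof.
intros Hg Hf; apply is_derive_coords in Hf; destruct Hf as (H1 & H2 & H3).
apply is_derive_coords; split; [|split];
  [apply (is_derive_mult g (fun u => px (f u)))
  |apply (is_derive_mult g (fun u => py (f u)))
  |apply (is_derive_mult g (fun u => pz (f u)))];
  auto; intros; apply Rmult_comm.
Qed.

Lemma is_derive_const_scal_R3 (k : R) (f : R -> R3) t df :
  is_derive f t df -> is_derive (fun u => scal k (f u)) t (scal k df).
Proof.
intro Hf; apply is_derive_coords in Hf; destruct Hf as (H1 & H2 & H3).
apply is_derive_coords; split; [|split];
  [apply (is_derive_scal (fun u => px (f u)))
  |apply (is_derive_scal (fun u => py (f u)))
  |apply (is_derive_scal (fun u => pz (f u)))]; auto.
Qed.

Definition smooth3 (f : R -> R3) : Prop :=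
  smooth (fun t => px (f t)) /\ smooth (fun t => py (f t)) /\
  smooth (fun t => pz (f t)).

Definition strip_smooth3 (eps : R) (F : R -> R -> R3) : Prop :=
  strip_smooth eps (fun s t => px (F s t)) /\
  strip_smooth eps (fun s t => py (F s t)) /\
  strip_smooth eps (fun s t => pz (F s t)).

Lemma smooth3_smooth_curve f : smooth3 f <-> smooth_curve f.
Proof.
split.
- intros (H1 & H2 & H3) k t; auto.
- intro H; split; [|split]; intros k t; apply H.
Qed.

Lemma strip_smooth3_family eps F : strip_smooth3 eps F -> smooth_family eps F.
Proof.
intros (H1 & H2 & H3) k s t Hs.
split; [|split]; now apply strip_smooth_ex_diff_n with eps.
Qed.

Lemma smooth3_velocity f : smooth3 f -> smooth3 (velocity f).
Proof. intros (H1 & H2 & H3); split; [|split]; now apply smooth_Derive. Qed.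

Lemma smooth3_is_derive f t : smooth3 f -> is_derive f t (velocity f t).
Proof.
intros (H1 & H2 & H3); apply is_derive_coords; split; [|split];
  now apply smooth_is_derive.
Qed.

Lemma smooth3_scal g f : smooth g -> smooth3 f -> smooth3 (fun t => scal (g t) (f t)).
Proof.
intros Hg (H1 & H2 & H3); split; [|split]; now apply smooth_mult.
Qed.

Lemma smooth3_plus f g : smooth3 f -> smooth3 g -> smooth3 (fun t => plus (f t) (g t)).
Proof.
intros (H1 & H2 & H3) (H4 & H5 & H6); split; [|split]; now apply smooth_plus.
Qed.

Lemma smooth3_minus f g : smooth3 f -> smooth3 g -> smooth3 (fun t => minus (f t) (g t)).
Proof.
intros (H1 & H2 & H3) (H4 & H5 & H6); split; [|split]; now apply smooth_minus.
Qed.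

Lemma smooth3_const p : smooth3 (fun _ => p).
Proof. split; [|split]; apply smooth_const. Qed.

Lemma smooth_dot f g : smooth3 f -> smooth3 g -> smooth (fun t => dot (f t) (g t)).
Proof.
intros (H1 & H2 & H3) (H4 & H5 & H6); unfold dot.
apply smooth_plus; [apply smooth_plus|]; now apply smooth_mult.
Qed.

Lemma strip_smooth3_scal eps g f : strip_smooth eps g -> strip_smooth3 eps f ->
  strip_smooth3 eps (fun s t => scal (g s t) (f s t)).
Proof.
intros Hg (H1 & H2 & H3); split; [|split]; now apply strip_smooth_mult.
Qed.

Lemma strip_smooth3_plus eps f g : strip_smooth3 eps f -> strip_smooth3 eps g ->
  strip_smooth3 eps (fun s t => plus (f s t) (g s t)).
Proof.
intros (H1 & H2 & H3) (H4 & H5 & H6); split; [|split]; now apply strip_smooth_plus.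
Qed.

Lemma strip_smooth3_minus eps f g : strip_smooth3 eps f -> strip_smooth3 eps g ->
  strip_smooth3 eps (fun s t => minus (f s t) (g s t)).
Proof.
intros (H1 & H2 & H3) (H4 & H5 & H6); split; [|split]; now apply strip_smooth_minus.
Qed.

Lemma strip_smooth_dot eps f g : strip_smooth3 eps f -> strip_smooth3 eps g ->
  strip_smooth eps (fun s t => dot (f s t) (g s t)).
Proof.
intros (H1 & H2 & H3) (H4 & H5 & H6); unfold dot.
apply strip_smooth_plus; [apply strip_smooth_plus|]; now apply strip_smooth_mult.
Qed.

Lemma strip_smooth_det eps p q r :
  strip_smooth3 eps p -> strip_smooth3 eps q -> strip_smooth3 eps r ->
  strip_smooth eps (fun s t => det (p s t) (q s t) (r s t)).
Proof.
intros Hp (H1 & H2 & H3) (H4 & H5 & H6); apply strip_smooth_dot; [exact Hp|].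
split; [|split]; unfold cross; cbn [px py pz fst snd];
  apply strip_smooth_minus; now apply strip_smooth_mult.
Qed.

Lemma strip_smooth3_cramer eps g1 g2 g3 r :
  strip_smooth3 eps g1 -> strip_smooth3 eps g2 -> strip_smooth3 eps g3 ->
  strip_smooth3 eps r ->
  (forall s t, Rabs s < eps -> det (g1 s t) (g2 s t) (g3 s t) <> 0) ->
  strip_smooth3 eps (fun s t => cramer (g1 s t) (g2 s t) (g3 s t) (r s t)).
Proof.
intros H1 H2 H3 Hr Hd; split; [|split]; unfold cramer, px, py, pz; cbn [fst snd];
  apply strip_smooth_div; try exact Hd; now apply strip_smooth_det.
Qed.

Lemma strip_smooth3_time eps f : smooth3 f -> strip_smooth3 eps (fun _ t => f t).
Proof. intros (H1 & H2 & H3); split; [|split]; now apply strip_smooth_time. Qed.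

Lemma smooth3_strip_slice eps F s : strip_smooth3 eps F -> Rabs s < eps -> smooth3 (F s).
Proof.
intros (H1 & H2 & H3) Hs; split; [|split].
- exact (smooth_strip_slice eps _ s H1 Hs).
- exact (smooth_strip_slice eps _ s H2 Hs).
- exact (smooth_strip_slice eps _ s H3 Hs).
Qed.

Lemma unit_perp_velocity v t : smooth3 v -> (forall t, dot (v t) (v t) = 1) ->
  dot (v t) (velocity v t) = 0.
Proof.
intros Hv H1.
pose proof (smooth3_is_derive _ t Hv) as Dv.
pose proof (is_derive_unique _ _ _ (is_derive_dot _ _ _ _ _ Dv Dv)) as H.
rewrite (Derive_ext _ (fun _ => 1)), Derive_const, dot_comm in H by exact H1.
lra.
Qed.

Definition RInt3 (f : R -> R3) (a b : R) : R3 :=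
  (RInt (fun t => px (f t)) a b, RInt (fun t => py (f t)) a b,
   RInt (fun t => pz (f t)) a b).

Lemma RInt3_point f a : RInt3 f a a = zero.
Proof. unfold RInt3; rewrite !RInt_point; reflexivity. Qed.

Lemma dot_RInt3 n f a b : smooth3 f ->
  dot n (RInt3 f a b) = RInt (fun t => dot n (f t)) a b.
Proof.
intros (H1 & H2 & H3); unfold dot, RInt3; autorewrite with coords.
symmetry; apply is_RInt_unique.
apply @is_RInt_plus; [apply @is_RInt_plus|]; apply @is_RInt_scal;
  apply @RInt_correct; now apply smooth_ex_RInt.
Qed.

Lemma is_derive_RInt3 f a t : smooth3 f -> is_derive (RInt3 f a) t (f t).
Proof.
intros (H1 & H2 & H3); apply is_derive_coords; unfold RInt3.
split; [|split]; autorewrite with coords.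
- exact (smooth_is_derive_RInt _ a t H1).
- exact (smooth_is_derive_RInt _ a t H2).
- exact (smooth_is_derive_RInt _ a t H3).
Qed.

Lemma smooth3_RInt3 f a : smooth3 f -> smooth3 (RInt3 f a).
Proof.
intros (H1 & H2 & H3); split; [|split].
- exact (smooth_RInt _ a H1).
- exact (smooth_RInt _ a H2).
- exact (smooth_RInt _ a H3).
Qed.

(** * Bicycle paths *)

Definition frame (x y : R -> R3) (t : R) : R3 := minus (x t) (y t).

Definition back_speed (x y : R -> R3) (t : R) : R :=
  dot (velocity y t) (frame x y t).

Lemma smooth3_front x y : bicycle_path x y -> smooth3 x.
Proof. intro H; apply smooth3_smooth_curve, H. Qed.

Lemma smooth3_back x y : bicycle_path x y -> smooth3 y.
Proof. intro H; apply smooth3_smooth_curve, H. Qed.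

Lemma smooth3_frame x y : bicycle_path x y -> smooth3 (frame x y).
Proof.
intro H; apply smooth3_minus; [now apply smooth3_front with y|].
now apply smooth3_back with x.
Qed.

Lemma smooth_back_speed x y : bicycle_path x y -> smooth (back_speed x y).
Proof.
intro H; apply smooth_dot; [|now apply smooth3_frame].
apply smooth3_velocity; now apply smooth3_back with x.
Qed.

Lemma frame_unit x y t :
  bicycle_path x y -> dot (frame x y t) (frame x y t) = 1.
Proof. intro H; apply norm_one, H. Qed.

Lemma is_derive_back x y t : bicycle_path x y ->
  is_derive y t (scal (back_speed x y t) (frame x y t)).
Proof.
intro Hpath; pose proof Hpath as (_ & _ & _ & H); destruct (H t) as [c Hc].
replace (back_speed x y t) with c; [exact Hc|].
unfold back_speed; rewrite (velocity_unique _ _ _ Hc).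
fold (frame x y t); rewrite dot_scal_l, frame_unit by exact Hpath; ring.
Qed.

Lemma front_eq (x y : R -> R3) t : x t = plus (y t) (frame x y t).
Proof. unfold frame; r3_ring. Qed.

Lemma is_derive_front x y t : bicycle_path x y ->
  is_derive x t (plus (scal (back_speed x y t) (frame x y t))
                      (velocity (frame x y) t)).
Proof.
intro H; apply is_derive_ext with (fun u => plus (y u) (frame x y u)).
{ intro; symmetry; apply front_eq. }
apply @is_derive_plus; [now apply is_derive_back|].
now apply smooth3_is_derive, smooth3_frame.
Qed.

Lemma frame_speed x y t : bicycle_path x y -> arc_length_parametrized x ->
  back_speed x y t ^ 2 + dot (velocity (frame x y) t) (velocity (frame x y) t) = 1.
Proof.
intros Hpath Harc; pose proof (proj1 (norm_one _) (Harc t)) as H.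
rewrite (velocity_unique _ _ _ (is_derive_front _ _ t Hpath)) in H.
rewrite dot_plus_l, !dot_plus_r, !dot_scal_l, !dot_scal_r, frame_unit,
  (dot_comm (velocity _ _) (frame x y t)), unit_perp_velocity in H
  by (auto using smooth3_frame, frame_unit); lra.
Qed.

(** Independence of the coordinate functions of v over the interval. *)
Definition spans_on (v : R -> R3) (a b : R) : Prop :=
  forall n, (forall t, a < t < b -> dot n (v t) = 0) -> n = zero.

(** If n.v vanishes identically then so does (n.y)' = c (n.v); hence n.y and
    n.x = n.y + n.v are constant, and x is planar. *)
Lemma nonplanar_frame_spans x y : bicycle_path x y -> ~ planar x ->
  forall n, (forall t, dot n (frame x y t) = 0) -> n = zero.
Proof.
intros Hpath Hnp n Hn; apply NNPP; intro Hn0; apply Hnp.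
assert (H : forall t, is_derive (fun u => dot n (y u)) t 0).
{ intro t.
  pose proof (is_derive_dot (fun _ => n) y t zero _ (is_derive_const n t)
    (is_derive_back x y t Hpath)) as H.
  cbv beta in H; rewrite dot_zero_l, dot_scal_r, Hn, Rmult_0_r, Rplus_0_r in H.
  exact H. }
exists n, (dot n (y 0)); split; [exact Hn0|]; intro t.
rewrite (front_eq x y t), dot_plus_r, Hn, Rplus_0_r.
exact (is_derive_zero_const _ H t 0).
Qed.

(** Three instants with linearly independent values of v can be chosen one
    after the other; any interval containing all three will do. *)
Lemma spans_on_interval (v : R -> R3) :
  (forall n, (forall t, dot n (v t) = 0) -> n = zero) ->
  exists L, 0 < L /\ forall a b, a <= - L -> L <= b -> spans_on v a b.
Proof.
intro Hspan.
assert (Hfind : forall n, n <> zero -> exists t, dot n (v t) <> 0).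
{ intros n Hn; apply NNPP; intro H; apply Hn, Hspan; intro t.
  apply NNPP; intro Ht; apply H; now exists t. }
destruct (Hfind (1, 0, 0)) as [t1 Ht1].
{ intro E; apply (f_equal px) in E; revert E; coords; lra. }
assert (Hv1 : v t1 <> zero) by (intro E; apply Ht1; rewrite E; apply dot_zero_r).
assert (H2 : exists t2, cross (v t1) (v t2) <> zero).
{ apply NNPP; intro H; destruct (nonzero_perp (v t1)) as [n [Hn Hn1]].
  destruct (Hfind n Hn) as [t Ht]; apply Ht.
  apply cross_zero_perp with (v t1); auto.
  apply NNPP; intro E; apply H; now exists t. }
destruct H2 as [t2 Ht2].
destruct (Hfind _ Ht2) as [t3 Ht3].
exists (1 + Rabs t1 + Rabs t2 + Rabs t3).
pose proof (Rabs_pos t1); pose proof (Rabs_pos t2); pose proof (Rabs_pos t3).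
split; [lra|]; intros a b Ha Hb n Hn.
assert (Hin : forall t, Rabs t <= Rabs t1 + Rabs t2 + Rabs t3 -> dot n (v t) = 0).
{ intros t Ht; apply Hn; apply Rabs_le_between in Ht; lra. }
pose proof (Hin t1 ltac:(lra)) as E1; pose proof (Hin t2 ltac:(lra)) as E2;
  pose proof (Hin t3 ltac:(lra)) as E3.
apply (perp_det_zero (v t1) (v t2) (v t3)); try assumption.
replace (det (v t1) (v t2) (v t3)) with (dot (cross (v t1) (v t2)) (v t3))
  by (unfold det; r3_ring).
exact Ht3.
Qed.

(** * The first variation of length *)

(** Divided by 1 + s^2 |eta|^2 this is a point of the unit sphere: the inverse
    stereographic image of s eta, a curve in s that leaves v with velocity
    2 eta. Without the denominator, which is moved into the speed of the back
    wheel, every integral over t below is a polynomial in s. *)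
Definition bend (eta v : R3) (s : R) : R3 :=
  plus (scal (1 - s ^ 2 * dot eta eta) v) (scal (2 * s) eta).

Lemma bend_dot eta v s : dot v v = 1 -> dot eta v = 0 ->
  dot (bend eta v s) (bend eta v s) = (1 + s ^ 2 * dot eta eta) ^ 2.
Proof.
intros Hv He; unfold bend.
rewrite dot_plus_l, !dot_plus_r, !dot_scal_l, !dot_scal_r, (dot_comm v eta), Hv, He.
ring.
Qed.

Definition bend_velocity (eta v : R -> R3) (s t : R) : R3 :=
  plus (plus (scal (- (s ^ 2 * (2 * dot (eta t) (velocity eta t)))) (v t))
             (scal (1 - s ^ 2 * dot (eta t) (eta t)) (velocity v t)))
       (scal (2 * s) (velocity eta t)).

Lemma is_derive_bend eta v s t : smooth3 eta -> smooth3 v ->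
  is_derive (fun t => bend (eta t) (v t) s) t (bend_velocity eta v s t).
Proof.
intros He Hv; unfold bend, bend_velocity.
pose proof (smooth3_is_derive _ t He) as De.
pose proof (smooth3_is_derive _ t Hv) as Dv.
apply @is_derive_plus.
- apply (is_derive_scal_R3 (fun t => 1 - s ^ 2 * dot (eta t) (eta t))); [|exact Dv].
  pose proof (is_derive_dot _ _ _ _ _ De De) as H.
  rewrite (dot_comm (velocity eta t)) in H.
  replace (- (s ^ 2 * (2 * dot (eta t) (velocity eta t)))) with
    (0 - s ^ 2 * (dot (eta t) (velocity eta t) + dot (eta t) (velocity eta t)))
    by ring.
  apply @is_derive_minus; [apply @is_derive_const|].
  apply is_derive_scal; exact H.
- apply is_derive_const_scal_R3; exact De.
Qed.

Lemma inv_pow2_le_1 D : 1 <= D -> 0 < / D ^ 2 <= 1.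
Proof.
intro HD; assert (1 <= D ^ 2) by nra.
split; [apply Rinv_0_lt_compat; lra|].
rewrite <- Rinv_1; apply Rinv_le_contravar; lra.
Qed.

(** Here p = [bend], q = p' and |p| = D, so V is the velocity of a front track
    whose frame is p / D and whose back wheel has velocity g p. The speed of the frame is bounded by that of p,
    since |(p / D)'|^2 = (|q|^2 - D'^2) / D^2, and r <= (1 + r^2) / 2 removes
    the square root. *)
Lemma deformed_speed_le (g Dt D : R) (p q : R3) :
  1 <= D -> dot p p = D ^ 2 -> dot p q = D * Dt ->
  let V := plus (scal g p) (plus (scal (- Dt / D ^ 2) p) (scal (/ D) q)) in
  norm V <= (1 + ((D * g) ^ 2 + dot q q)) / 2.
Proof.
intros HD Hp Hq V.
assert (HV : dot V V = (D * g) ^ 2 + (dot q q - Dt ^ 2) * / D ^ 2).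
{ unfold V.
  rewrite !dot_plus_l, !dot_plus_r, !dot_scal_l, !dot_scal_r, (dot_comm q p), Hp, Hq.
  field; lra. }
assert (Hle : dot V V <= (D * g) ^ 2 + dot q q).
{ rewrite HV; pose proof (inv_pow2_le_1 D HD); pose proof (dot_self_pos q).
  assert (0 <= Dt ^ 2) by apply pow2_ge_0; nra. }
rewrite norm_R3.
pose proof (sqrt_pos (dot V V)); pose proof (sqrt_sqrt _ (dot_self_pos V)).
assert (0 <= (sqrt (dot V V) - 1) ^ 2) by apply pow2_ge_0.
lra.
Qed.

(** Fermat's rule for g - f. It lets a smooth upper bound take the place of the
    length, so that no square root has to be differentiated. *)
Lemma derive_le_zero (f g : R -> R) l eps : 0 < eps ->
  (forall s, Rabs s < eps -> f s <= g s) -> f 0 = g 0 ->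
  is_derive f 0 0 -> is_derive g 0 l -> l = 0.
Proof.
intros He Hle H0 Hf Hg.
assert (Hd : is_derive (fun s => g s - f s) 0 l).
{ replace l with (l - 0) by ring. now apply @is_derive_minus. }
apply is_derive_Reals in Hd.
assert (pr : derivable_pt (fun s => g s - f s) 0) by (exists l; exact Hd).
rewrite <- (deriv_minimum _ (- eps) eps 0 pr) by
  (try lra; intros s H1 H2; pose proof (Hle s); rewrite H0;
   assert (Rabs s < eps) by (apply Rabs_def1; lra); lra).
symmetry; apply derive_pt_eq; exact Hd.
Qed.

Lemma is_derive_quadratic (f : R -> R) (k0 k1 k2 : R) :
  (forall s, f s = k0 + k1 * s + k2 * s ^ 2) -> is_derive f 0 k1.
Proof.
intro H; apply is_derive_ext with (fun s => k0 + k1 * s + k2 * s ^ 2).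
- intro; symmetry; apply H.
- auto_derive; [trivial|ring].
Qed.

Lemma is_derive_energy (D g f : R -> R) s dD dg df :
  is_derive D s dD -> is_derive g s dg -> is_derive f s df ->
  is_derive (fun u => (1 + ((D u * g u) ^ 2 + f u)) / 2) s
    (D s * g s * (dD * g s + D s * dg) + df / 2).
Proof.
intros H1 H2 H3; auto_derive.
- repeat split; eexists; eassumption.
- change (fun x => D x) with D; change (fun x => g x) with g;
    change (fun x => f x) with f.
  rewrite (is_derive_unique _ _ _ H1), (is_derive_unique _ _ _ H2),
    (is_derive_unique _ _ _ H3); field.
Qed.

(** The family deforms the frame by [bend] in the direction eta and the signed
    speed of the back wheel to (1 + s^2 |eta|^2) gamma. Its length is at most
    the integral of (1 + ((1 + s^2 |eta|^2) gamma)^2 + |bend'|^2) / 2, with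
    equality at s = 0 because the geodesic has unit speed; so this integral is
    critical as well, and its derivative is the one displayed. *)
Lemma first_variation (x y : R -> R3) (a b eps : R)
  (gamma : R -> R -> R) (eta : R -> R3) (Y : R -> R -> R3) :
  bicycling_geodesic x y -> arc_length_parametrized x ->
  a < b -> 0 < eps ->
  strip_smooth eps gamma -> (forall t, gamma 0 t = back_speed x y t) ->
  smooth3 eta -> (forall t, dot (eta t) (frame x y t) = 0) ->
  eta a = zero -> eta b = zero ->
  strip_smooth3 eps Y -> (forall t, Y 0 t = y t) ->
  (forall s, Rabs s < eps -> Y s a = y a /\ Y s b = y b) ->
  (forall s t, Rabs s < eps ->
     is_derive (Y s) t (scal (gamma s t) (bend (eta t) (frame x y t) s))) ->
  RInt (fun t => back_speed x y t * Derive (fun u => gamma u t) 0 +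
                 2 * dot (velocity (frame x y) t) (velocity eta t)) a b = 0.
Proof.
intros [Hpath Hcrit] Harc Hab Heps Hg Hg0 Heta Hperp Ha Hb HY HY0 HYab HYd.
pose (v := frame x y); pose (c := back_speed x y).
fold v c in Hg0, Hperp, HYd |- *.
assert (Hv : smooth3 v) by now apply smooth3_frame.
assert (Hvv : forall t, dot (v t) (v t) = 1) by (intro; now apply frame_unit).
pose (q := fun t => dot (eta t) (eta t)).
assert (Hq : smooth q) by now apply smooth_dot.
pose (D := fun s t => 1 + s ^ 2 * q t).
assert (HD : forall s t, 1 <= D s t).
{ intros s t; unfold D, q; pose proof (dot_self_pos (eta t)).
  assert (0 <= s ^ 2) by apply pow2_ge_0; nra. }
pose (P := fun s t => bend (eta t) (v t) s).
assert (HDs : strip_smooth eps D).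
{ apply strip_smooth_plus; [apply strip_smooth_const|].
  apply strip_smooth_mult; [apply strip_smooth_pow, strip_smooth_param|].
  now apply strip_smooth_time. }
assert (HPs : strip_smooth3 eps P).
{ apply strip_smooth3_plus; apply strip_smooth3_scal;
    try now apply strip_smooth3_time.
  - apply strip_smooth_minus; [apply strip_smooth_const|].
    apply strip_smooth_mult; [apply strip_smooth_pow, strip_smooth_param|].
    now apply strip_smooth_time.
  - apply strip_smooth_mult; [apply strip_smooth_const|apply strip_smooth_param]. }
assert (HPP : forall s t, dot (P s t) (P s t) = D s t ^ 2).
{ intros s t; exact (bend_dot _ _ s (Hvv t) (Hperp t)). }
pose (V (s t : R) := scal (/ D s t) (P s t) : R3).
pose (X (s t : R) := plus (Y s t) (V s t) : R3).
assert (HVs : strip_smooth3 eps V).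
{ apply strip_smooth3_scal; [|exact HPs]. apply strip_smooth_inv; [|exact HDs].
  intros s t _; specialize (HD s t); lra. }
assert (HXs : strip_smooth3 eps X) by now apply strip_smooth3_plus.
pose (Pt := bend_velocity eta v).
assert (HPd : forall s t, is_derive (P s) t (Pt s t)).
{ intros s t; exact (is_derive_bend eta v s t Heta Hv). }
assert (HPts : strip_smooth3 eps Pt).
{ assert (He' := smooth3_velocity _ Heta); assert (Hv' := smooth3_velocity _ Hv).
  assert (Hs2 : strip_smooth eps (fun s _ => s ^ 2))
    by apply strip_smooth_pow, strip_smooth_param.
  apply strip_smooth3_plus; [apply strip_smooth3_plus|]; apply strip_smooth3_scal;
    try now apply strip_smooth3_time.
  - apply strip_smooth_opp, strip_smooth_mult; [exact Hs2|].
    apply strip_smooth_mult; [apply strip_smooth_const|].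
    now apply strip_smooth_time, smooth_dot.
  - apply strip_smooth_minus; [apply strip_smooth_const|].
    apply strip_smooth_mult; [exact Hs2|]. now apply strip_smooth_time.
  - apply strip_smooth_mult; [apply strip_smooth_const|apply strip_smooth_param]. }
pose (Dt := fun s t => Derive (D s) t).
assert (HDd : forall s t, Rabs s < eps -> is_derive (D s) t (Dt s t)).
{ intros s t Hs; apply smooth_is_derive; now apply smooth_strip_slice with eps. }
assert (HVd : forall s t, Rabs s < eps ->
  is_derive (V s) t (plus (scal (- Dt s t / D s t ^ 2) (P s t))
                          (scal (/ D s t) (Pt s t)))).
{ intros s t Hs.
  apply (is_derive_scal_R3 (fun u => / D s u) (P s) t (- Dt s t / D s t ^ 2) (Pt s t));
    [|apply HPd].
  apply (is_derive_inv (D s) t (Dt s t)); [now apply HDd|]. specialize (HD s t); lra. }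
assert (HXd : forall s t, Rabs s < eps -> velocity (X s) t =
  plus (scal (gamma s t) (P s t))
    (plus (scal (- Dt s t / D s t ^ 2) (P s t)) (scal (/ D s t) (Pt s t)))).
{ intros s t Hs; apply velocity_unique.
  apply @is_derive_plus; [now apply HYd|now apply HVd]. }
assert (HPPt : forall s t, Rabs s < eps -> dot (P s t) (Pt s t) = D s t * Dt s t).
{ intros s t Hs.
  pose proof (is_derive_dot _ _ _ _ _ (HPd s t) (HPd s t)) as H1.
  apply is_derive_unique in H1.
  rewrite (Derive_ext _ (fun u => D s u ^ 2)) in H1 by (intro; apply HPP).
  pose proof (HDd s t Hs) as H2.
  rewrite Derive_pow in H1 by (eexists; exact H2).
  fold (Dt s t) in H1; simpl in H1; rewrite (dot_comm (Pt s t)) in H1; lra. }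
(* An upper bound for the speed of the deformed front track. *)
pose (E := fun s t => (1 + ((D s t * gamma s t) ^ 2 + dot (Pt s t) (Pt s t))) / 2).
assert (HEs : strip_smooth eps E).
{ apply strip_smooth_mult; [|apply strip_smooth_const].
  apply strip_smooth_plus; [apply strip_smooth_const|].
  apply strip_smooth_plus; [|now apply strip_smooth_dot].
  now apply strip_smooth_pow, strip_smooth_mult. }
assert (H0 : Rabs 0 < eps) by now rewrite Rabs_R0.
assert (HP0 : forall t, P 0 t = v t) by (intro; unfold P, bend; r3_ring).
assert (HPt0 : forall t, Pt 0 t = velocity v t)
  by (intro; unfold Pt, bend_velocity; r3_ring).
assert (HD0 : forall t, D 0 t = 1) by (intro; unfold D; ring).
assert (HE0 : forall t, Derive (fun u => E u t) 0 =
  c t * Derive (fun u => gamma u t) 0 + 2 * dot (velocity v t) (velocity eta t)).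
{ intro t; apply is_derive_unique.
  destruct (strip_smooth_derives _ _ Hg) as (_ & _ & Hgd).
  destruct (Hgd 0 t H0) as [Hgd0 _].
  assert (HDs0 : is_derive (fun u => D u t) 0 0).
  { apply is_derive_quadratic with 1 (q t); intro; unfold D; ring. }
  assert (HPts0 : is_derive (fun u => Pt u t) 0 (scal 2 (velocity eta t))).
  { apply is_derive_coords; unfold Pt, bend_velocity; fold (q t).
    split; [|split]; autorewrite with coords.
    - apply is_derive_quadratic with (px (velocity v t))
        (- (2 * dot (eta t) (velocity eta t)) * px (v t) - q t * px (velocity v t)).
      intro; coords; unfold q; coords; ring.
    - apply is_derive_quadratic with (py (velocity v t))
        (- (2 * dot (eta t) (velocity eta t)) * py (v t) - q t * py (velocity v t)).
      intro; coords; unfold q; coords; ring.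
    - apply is_derive_quadratic with (pz (velocity v t))
        (- (2 * dot (eta t) (velocity eta t)) * pz (v t) - q t * pz (velocity v t)).
      intro; coords; unfold q; coords; ring. }
  pose proof (is_derive_dot _ _ _ _ _ HPts0 HPts0) as H1.
  cbv beta in H1; rewrite HPt0, dot_scal_l, dot_scal_r, (dot_comm (velocity eta t)) in H1.
  replace (c t * _ + _) with
    (D 0 t * gamma 0 t * (0 * gamma 0 t + D 0 t * Derive (fun u => gamma u t) 0) +
     (2 * dot (velocity v t) (velocity eta t) +
      2 * dot (velocity v t) (velocity eta t)) / 2)
    by (rewrite HD0, Hg0; field).
  exact (is_derive_energy (fun u => D u t) (fun u => gamma u t) _ 0 _ _ _ HDs0 Hgd0 H1). }
assert (HE : is_derive (fun s => RInt (E s) a b) 0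
  (RInt (fun t => Derive (fun u => E u t) 0) a b)).
{ now apply is_derive_RInt_strip with eps. }
rewrite (RInt_ext _ (fun t => c t * Derive (fun u => gamma u t) 0 +
   2 * dot (velocity v t) (velocity eta t))) in HE by (intros; apply HE0).
assert (Hx0 : forall t, X 0 t = x t).
{ intro t; rewrite (front_eq x y t); fold v; unfold X, V.
  rewrite HY0, HD0, HP0, Rinv_1; r3_ring. }
assert (HL : is_derive (fun s => curve_length (X s) a b) 0 0).
{ apply (Hcrit a b Hab eps X Y).
  split; [exact Heps|split; [now apply strip_smooth3_family|]].
  split; [now apply strip_smooth3_family|split; [|split]].
  - intros s Hs; split; [|split; [|split]].
    + apply smooth3_smooth_curve; now apply smooth3_strip_slice with eps.
    + apply smooth3_smooth_curve; now apply smooth3_strip_slice with eps.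
    + intro t; replace (minus (X s t) (Y s t)) with (V s t)
        by (unfold X; r3_ring).
      apply norm_one; unfold V.
      rewrite dot_scal_l, dot_scal_r, HPP; specialize (HD s t); field; lra.
    + intro t; exists (gamma s t * D s t).
      replace (scal _ _) with (scal (gamma s t) (P s t)); [now apply HYd|].
      unfold X, V; specialize (HD s t); apply R3_ext; coords; field; lra.
  - intros t _; split; [apply Hx0|apply HY0].
  - intros s Hs; destruct (HYab s Hs) as [HYa HYb].
    assert (Hend : forall t, eta t = zero -> V s t = v t).
    { intros t Ht; unfold V, D, P, q, bend; rewrite Ht.
      rewrite dot_zero_l, Rmult_0_r, Rplus_0_r, Rinv_1; r3_ring. }
    split; [|split; [exact HYa|split; [|exact HYb]]].
    + unfold X; rewrite HYa, Hend by exact Ha; symmetry; apply front_eq.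
    + unfold X; rewrite HYb, Hend by exact Hb; symmetry; apply front_eq. }
apply (derive_le_zero _ _ _ eps Heps) with (3 := HL) (4 := HE).
- intros s Hs; unfold curve_length; apply RInt_le; [lra| | |].
  + apply @ex_RInt_continuous; intros t _.
    apply continuous_ext with (fun t => sqrt (dot (velocity (X s) t) (velocity (X s) t))).
    { intro; symmetry; apply norm_R3. }
    apply continuous_comp; [|apply continuous_sqrt].
    apply smooth_continuous.
    apply smooth_dot; apply smooth3_velocity; now apply smooth3_strip_slice with eps.
  + apply smooth_ex_RInt; now apply smooth_strip_slice with eps.
  + intros t _; rewrite HXd by exact Hs; unfold E.
    apply deformed_speed_le; auto.
- unfold curve_length; apply RInt_ext; intros t _.
  replace (velocity (X 0) t) with (velocity x t).
  + rewrite (Harc t); unfold E; rewrite HPt0, HD0, Hg0.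
    pose proof (frame_speed x y t Hpath Harc) as H; fold v c in H; lra.
  + unfold velocity; rewrite (Derive_ext (fun u => px (X 0 u)) (fun u => px (x u))),
      (Derive_ext (fun u => py (X 0 u)) (fun u => py (x u))),
      (Derive_ext (fun u => pz (X 0 u)) (fun u => pz (x u)));
      try (intro; now rewrite Hx0); reflexivity.
Qed.

(** * Varying the speed of the back wheel *)

Definition moment (f : R -> R) (v : R -> R3) : R -> R -> R3 :=
  RInt3 (fun t => scal (f t) (v t)).

Lemma is_derive_moment h v a t : smooth h -> smooth3 v ->
  is_derive (moment h v a) t (scal (h t) (v t)).
Proof.
intros Hh Hv; apply (is_derive_RInt3 (fun t => scal (h t) (v t))).
now apply smooth3_scal.
Qed.

Lemma smooth3_moment h v a : smooth h -> smooth3 v -> smooth3 (moment h v a).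
Proof. intros Hh Hv; apply smooth3_RInt3; now apply smooth3_scal. Qed.

Lemma moment_dot n v a b : smooth3 v ->
  moment (fun t => dot n (v t)) v a b =
  (dot n (moment (fun t => px (v t)) v a b),
   dot n (moment (fun t => py (v t)) v a b),
   dot n (moment (fun t => pz (v t)) v a b)).
Proof.
intro Hv; pose proof Hv as (H1 & H2 & H3).
unfold moment; rewrite !dot_RInt3 by now apply smooth3_scal.
unfold RInt3; apply R3_ext; autorewrite with coords; apply RInt_ext_everywhere;
  intro t; rewrite dot_scal_r; autorewrite with coords; R_eq; ring.
Qed.

(** The three columns form the Gram matrix of the coordinate functions of v,
    so a kernel vector n makes the integral of (n.v)^2 vanish. *)
Lemma gram_det v a b : a < b -> smooth3 v -> spans_on v a b ->
  det (moment (fun t => px (v t)) v a b) (moment (fun t => py (v t)) v a b)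
      (moment (fun t => pz (v t)) v a b) <> 0.
Proof.
intros Hab Hv Hspan Hd; destruct (det_zero_perp _ _ _ Hd) as (n & Hn & H1 & H2 & H3).
apply Hn, Hspan.
assert (Hnv : smooth (fun t => dot n (v t))).
{ apply smooth_dot; [apply smooth3_const|exact Hv]. }
assert (H0 : RInt (fun t => dot n (v t) * dot n (v t)) a b = 0).
{ transitivity (dot n (moment (fun t => dot n (v t)) v a b)).
  - unfold moment; rewrite dot_RInt3 by now apply smooth3_scal.
    apply RInt_ext_everywhere; intro t; now rewrite dot_scal_r.
  - rewrite moment_dot, H1, H2, H3 by exact Hv; coords; R_eq; ring. }
intros t Ht.
apply Rsqr_0_uniq; unfold Rsqr.
apply (RInt_nonneg_zero (fun t => dot n (v t) * dot n (v t)) a b Hab);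
  [|intros; apply Rle_0_sqr|exact H0|exact Ht].
now apply smooth_mult.
Qed.

(** Let A.v be the orthogonal projection of c onto the span of the coordinates
    of v, in the sense of square-integrable functions. The remainder d has
    zero integral against v, so c + s d is an admissible speed for the same
    frame; criticality says that c, hence also d, is orthogonal to d. *)
Lemma back_speed_linear_on x y a b :
  bicycling_geodesic x y -> arc_length_parametrized x ->
  a < b -> spans_on (frame x y) a b ->
  exists A, forall t, a < t < b -> back_speed x y t = dot A (frame x y t).
Proof.
intros Hgeo Harc Hab Hspan.
pose proof (proj1 Hgeo) as Hpath.
set (v := frame x y) in *; set (c := back_speed x y).
assert (Hv : smooth3 v) by now apply smooth3_frame.
assert (Hc : smooth c) by now apply smooth_back_speed.
pose proof Hv as (Hv1 & Hv2 & Hv3).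
set (g1 := moment (fun t => px (v t)) v a b).
set (g2 := moment (fun t => py (v t)) v a b).
set (g3 := moment (fun t => pz (v t)) v a b).
assert (Hdet : det g1 g2 g3 <> 0) by now apply gram_det.
set (A := cramer g1 g2 g3 (moment c v a b)).
assert (HA : smooth (fun t => dot A (v t))).
{ apply smooth_dot; [apply smooth3_const|exact Hv]. }
assert (Hsym : forall n m, dot n (moment (fun t => dot m (v t)) v a b) =
                           dot m (moment (fun t => dot n (v t)) v a b)).
{ intros n m; unfold moment; rewrite !dot_RInt3.
  - apply RInt_ext_everywhere; intro t; rewrite !dot_scal_r; ring.
  - apply smooth3_scal; [apply smooth_dot; [apply smooth3_const|]|]; exact Hv.
  - apply smooth3_scal; [apply smooth_dot; [apply smooth3_const|]|]; exact Hv. }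
assert (HAm : moment (fun t => dot A (v t)) v a b = moment c v a b).
{ apply R3_ext_dot; intro n; rewrite Hsym, moment_dot by exact Hv; fold g1 g2 g3.
  rewrite <- (cramer_solves g1 g2 g3 (moment c v a b) Hdet); fold A.
  rewrite !dot_plus_r, !dot_scal_r.
  unfold dot at 1; autorewrite with coords; R_eq; ring. }
exists A; fold v c.
pose (d := fun t => c t - dot A (v t)).
assert (Hd : smooth d) by now apply smooth_minus.
assert (Hdv : forall n, RInt (fun t => d t * dot n (v t)) a b = 0).
{ intro n.
  assert (E : dot n (moment d v a b) =
              dot n (moment c v a b) - dot n (moment (fun t => dot A (v t)) v a b)).
  { unfold moment; rewrite !dot_RInt3 by now apply smooth3_scal.
    rewrite <- smooth_RInt_minus by (apply smooth_dot;
      [apply smooth3_const|now apply smooth3_scal]).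
    apply RInt_ext_everywhere; intro t; unfold d; r3_ring. }
  rewrite HAm, Rminus_diag in E; rewrite <- E; unfold moment.
  rewrite dot_RInt3 by now apply smooth3_scal.
  apply RInt_ext_everywhere; intro t; now rewrite dot_scal_r. }
assert (Hdv0 : moment d v a b = zero).
{ apply dot_all_zero; intro n; unfold moment.
  rewrite dot_RInt3 by now apply smooth3_scal.
  rewrite <- (Hdv n); apply RInt_ext_everywhere; intro t; now rewrite dot_scal_r. }
assert (Hcd : RInt (fun t => c t * d t) a b = 0).
{ rewrite <- (first_variation x y a b 1 (fun s t => c t + s * d t) (fun _ => zero)
    (fun s t => plus (y t) (scal s (moment d v a t))) Hgeo Harc Hab Rlt_0_1).
  - apply RInt_ext_everywhere; intro t; fold v c.
    rewrite (velocity_unique (fun _ => zero) t zero) by apply @is_derive_const.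
    rewrite dot_zero_r, (is_derive_unique _ _ (d t)); [ring|].
    apply is_derive_quadratic with (c t) 0; intro; ring.
  - apply strip_smooth_plus; [now apply strip_smooth_time|].
    apply strip_smooth_mult; [apply strip_smooth_param|now apply strip_smooth_time].
  - intro t; fold c; ring.
  - apply smooth3_const.
  - intro t; apply dot_zero_l.
  - reflexivity.
  - reflexivity.
  - apply strip_smooth3_plus; [apply strip_smooth3_time; now apply smooth3_back with x|].
    apply strip_smooth3_scal; [apply strip_smooth_param|].
    apply strip_smooth3_time, smooth3_RInt3; now apply smooth3_scal.
  - intro t; r3_ring.
  - intros s _; unfold moment at 1; rewrite RInt3_point, Hdv0.
    split; r3_ring.
  - intros s t _.
    replace (scal _ _) with (plus (scal (c t) (v t)) (scal s (scal (d t) (v t)))).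
    + apply @is_derive_plus; [now apply is_derive_back|].
      apply is_derive_const_scal_R3, (is_derive_RInt3 (fun t => scal (d t) (v t))).
      now apply smooth3_scal.
    + fold v; unfold bend; r3_ring. }
intros t Ht; cut (d t = 0); [unfold d; lra|].
apply Rsqr_0_uniq; unfold Rsqr.
apply (RInt_nonneg_zero (fun t => d t * d t) a b Hab);
  [now apply smooth_mult|intros; apply Rle_0_sqr| |exact Ht].
replace 0 with (RInt (fun t => c t * d t) a b - RInt (fun t => d t * dot A (v t)) a b)
  by (rewrite Hcd, Hdv; ring).
rewrite <- smooth_RInt_minus by now apply smooth_mult.
apply RInt_ext_everywhere; intro u; unfold d; ring.
Qed.

(** * Varying the frame *)

(** Displacement of the back wheel, from time a to time t, when the frame is
    the normalized [bend] and the signed speed is (1 + s^2 |eta|^2) h. *)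
Definition swept (h : R -> R) (eta v : R -> R3) (a s t : R) : R3 :=
  plus (plus (moment h v a t) (scal (2 * s) (moment h eta a t)))
    (scal (- s ^ 2) (moment (fun t => h t * dot (eta t) (eta t)) v a t)).

Lemma is_derive_swept h eta v a s t : smooth h -> smooth3 eta -> smooth3 v ->
  is_derive (swept h eta v a s) t (scal (h t) (bend (eta t) (v t) s)).
Proof.
intros Hh He Hv.
replace (scal (h t) (bend (eta t) (v t) s)) with
  (plus (plus (scal (h t) (v t)) (scal (2 * s) (scal (h t) (eta t))))
     (scal (- s ^ 2) (scal (h t * dot (eta t) (eta t)) (v t))) : R3)
  by (unfold bend; r3_ring).
apply @is_derive_plus; [apply @is_derive_plus|].
- now apply is_derive_moment.
- apply is_derive_const_scal_R3; now apply is_derive_moment.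
- apply is_derive_const_scal_R3.
  apply (is_derive_moment (fun t => h t * dot (eta t) (eta t))); [|exact Hv].
  apply smooth_mult; [exact Hh|now apply smooth_dot].
Qed.

Lemma strip_smooth3_quadratic eps f0 f1 f2 :
  smooth3 f0 -> smooth3 f1 -> smooth3 f2 ->
  strip_smooth3 eps (fun s t => plus (plus (f0 t) (scal (2 * s) (f1 t)))
                                 (scal (- s ^ 2) (f2 t))).
Proof.
intros H0 H1 H2.
apply strip_smooth3_plus; [apply strip_smooth3_plus|];
  try apply strip_smooth3_scal; try now apply strip_smooth3_time.
- apply strip_smooth_mult; [apply strip_smooth_const|apply strip_smooth_param].
- apply strip_smooth_opp, strip_smooth_pow, strip_smooth_param.
Qed.

Lemma strip_smooth3_swept eps h eta v a : smooth h -> smooth3 eta -> smooth3 v ->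
  strip_smooth3 eps (swept h eta v a).
Proof.
intros Hh He Hv; apply strip_smooth3_quadratic; apply smooth3_moment;
  try assumption.
apply smooth_mult; [exact Hh|now apply smooth_dot].
Qed.

Lemma strip_smooth3_swept_end eps h eta v a b :
  strip_smooth3 eps (fun s _ => swept h eta v a s b).
Proof.
exact (strip_smooth3_quadratic eps _ _ _ (smooth3_const (moment h v a b))
  (smooth3_const (moment h eta a b)) (smooth3_const _)).
Qed.

Lemma swept_start h eta v a s : swept h eta v a s a = zero.
Proof. unfold swept, moment; rewrite !RInt3_point; r3_ring. Qed.

Lemma swept_undeformed h eta v a t : swept h eta v a 0 t = moment h v a t.
Proof. unfold swept; r3_ring. Qed.

(** When the frame is deformed, the final position of the back wheel is
    restored by adding a combination of the coordinates of v to the speed. At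
    s = 0 the linear system for its coefficients has the Gram matrix of v, so
    it remains solvable for small s. *)
Lemma closing_correction (v eta : R -> R3) (c : R -> R) a b :
  a < b -> smooth3 v -> smooth3 eta -> smooth c -> spans_on v a b ->
  exists eps lambda, 0 < eps /\ strip_smooth3 eps (fun s _ => lambda s) /\
    lambda 0 = zero /\
    forall s, Rabs s < eps ->
      plus (plus (plus (swept c eta v a s b)
        (scal (px (lambda s)) (swept (fun t => px (v t)) eta v a s b)))
        (scal (py (lambda s)) (swept (fun t => py (v t)) eta v a s b)))
        (scal (pz (lambda s)) (swept (fun t => pz (v t)) eta v a s b))
      = moment c v a b.
Proof.
intros Hab Hv He Hc Hspan.
pose (g1 s := swept (fun t => px (v t)) eta v a s b).
pose (g2 s := swept (fun t => py (v t)) eta v a s b).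
pose (g3 s := swept (fun t => pz (v t)) eta v a s b).
pose (r s := minus (moment c v a b) (swept c eta v a s b) : R3).
assert (H0 : det (g1 0) (g2 0) (g3 0) <> 0).
{ unfold g1, g2, g3; rewrite !swept_undeformed; now apply gram_det. }
assert (Hg1 : forall e, strip_smooth3 e (fun s _ => g1 s))
  by exact (fun e => strip_smooth3_swept_end e (fun t => px (v t)) eta v a b).
assert (Hg2 : forall e, strip_smooth3 e (fun s _ => g2 s))
  by exact (fun e => strip_smooth3_swept_end e (fun t => py (v t)) eta v a b).
assert (Hg3 : forall e, strip_smooth3 e (fun s _ => g3 s))
  by exact (fun e => strip_smooth3_swept_end e (fun t => pz (v t)) eta v a b).
assert (Hr : forall e, strip_smooth3 e (fun s _ => r s)).
{ intro e; apply strip_smooth3_minus; [exact (strip_smooth3_time e _ (smooth3_const _))|].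
  exact (strip_smooth3_swept_end e c eta v a b). }
destruct (continuity_2d_pt_neq_0 (fun s _ => det (g1 s) (g2 s) (g3 s)) 0 0)
  as [d Hd].
{ refine (smooth_upto_continuous 1 O _ _ 0 0 _).
  - exact (strip_smooth_det 1 _ _ _ (Hg1 1) (Hg2 1) (Hg3 1) O).
  - rewrite Rabs_R0; lra. }
{ exact H0. }
assert (Hdet : forall s, Rabs s < d -> det (g1 s) (g2 s) (g3 s) <> 0).
{ intros s Hs; apply (Hd s 0).
  - now rewrite Rminus_0_r.
  - rewrite Rminus_0_r, Rabs_R0; apply cond_pos. }
exists d, (fun s => cramer (g1 s) (g2 s) (g3 s) (r s)).
split; [apply cond_pos|split; [|split]].
- apply strip_smooth3_cramer; auto.
- replace (r 0) with (zero : R3); [apply cramer_zero|].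
  unfold r; rewrite swept_undeformed; r3_ring.
- intros s Hs; pose proof (cramer_solves _ _ _ (r s) (Hdet s Hs)) as H.
  cbv zeta in H; fold (g1 s) (g2 s) (g3 s).
  assert (E : moment c v a b = plus (swept c eta v a s b) (r s)) by (unfold r; r3_ring).
  rewrite E; rewrite <- H at 4; r3_ring.
Qed.

(** Differentiating the closing condition expresses the integral of
    c (d gamma / d s) = (A.v) (d gamma / d s) through eta alone, which
    eliminates the correction from the first variation. *)
Lemma frame_variation x y a b A eta :
  bicycling_geodesic x y -> arc_length_parametrized x -> a < b ->
  spans_on (frame x y) a b ->
  (forall t, a < t < b -> back_speed x y t = dot A (frame x y t)) ->
  smooth3 eta -> (forall t, dot (eta t) (frame x y t) = 0) ->
  eta a = zero -> eta b = zero ->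
  RInt (fun t => dot (velocity (frame x y) t) (velocity eta t)
                 - back_speed x y t * dot A (eta t)) a b = 0.
Proof.
intros Hgeo Harc Hab Hspan HA He Hperp Ha Hb.
pose proof (proj1 Hgeo) as Hpath.
set (v := frame x y) in *; set (c := back_speed x y) in *.
assert (Hv : smooth3 v) by now apply smooth3_frame.
assert (Hc : smooth c) by now apply smooth_back_speed.
pose proof Hv as (Hv1 & Hv2 & Hv3).
destruct (closing_correction v eta c a b Hab Hv He Hc Hspan)
  as (eps & l & Heps & Hl & Hl0 & Hclose).
pose proof Hl as (Hl1 & Hl2 & Hl3).
pose (gamma s t := c t + dot (l s) (v t)).
assert (Hg : strip_smooth eps gamma).
{ apply strip_smooth_plus; [now apply strip_smooth_time|].
  apply (strip_smooth_dot eps (fun s _ => l s)); [exact Hl|now apply strip_smooth3_time]. }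
assert (Hg0 : forall t, gamma 0 t = c t).
{ intro t; unfold gamma; rewrite Hl0, dot_zero_l; ring. }
pose (W s t := plus (plus (plus (swept c eta v a s t)
        (scal (px (l s)) (swept (fun t => px (v t)) eta v a s t)))
        (scal (py (l s)) (swept (fun t => py (v t)) eta v a s t)))
        (scal (pz (l s)) (swept (fun t => pz (v t)) eta v a s t)) : R3).
assert (HW : strip_smooth3 eps W).
{ assert (HS : forall h, smooth h -> strip_smooth3 eps (swept h eta v a)).
  { intros h Hh; now apply strip_smooth3_swept. }
  apply strip_smooth3_plus; [apply strip_smooth3_plus; [apply strip_smooth3_plus|]|].
  - exact (HS _ Hc).
  - exact (strip_smooth3_scal eps _ _ Hl1 (HS _ Hv1)).
  - exact (strip_smooth3_scal eps _ _ Hl2 (HS _ Hv2)).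
  - exact (strip_smooth3_scal eps _ _ Hl3 (HS _ Hv3)). }
assert (HWd : forall s t, is_derive (W s) t (scal (gamma s t) (bend (eta t) (v t) s))).
{ intros s t.
  replace (scal (gamma s t) (bend (eta t) (v t) s)) with
    (plus (plus (plus (scal (c t) (bend (eta t) (v t) s))
       (scal (px (l s)) (scal (px (v t)) (bend (eta t) (v t) s))))
       (scal (py (l s)) (scal (py (v t)) (bend (eta t) (v t) s))))
       (scal (pz (l s)) (scal (pz (v t)) (bend (eta t) (v t) s))) : R3)
    by (unfold gamma; r3_ring).
  apply @is_derive_plus; [apply @is_derive_plus; [apply @is_derive_plus|]|].
  - exact (is_derive_swept c eta v a s t Hc He Hv).
  - exact (is_derive_const_scal_R3 _ _ t _
      (is_derive_swept (fun t => px (v t)) eta v a s t Hv1 He Hv)).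
  - exact (is_derive_const_scal_R3 _ _ t _
      (is_derive_swept (fun t => py (v t)) eta v a s t Hv2 He Hv)).
  - exact (is_derive_const_scal_R3 _ _ t _
      (is_derive_swept (fun t => pz (v t)) eta v a s t Hv3 He Hv)). }
assert (HW0 : forall t, W 0 t = moment c v a t).
{ intro t; unfold W; rewrite Hl0, swept_undeformed; r3_ring. }
assert (HWa : forall s, W s a = zero).
{ intro s; unfold W; rewrite !swept_start; r3_ring. }
pose (Y s t := plus (minus (y t) (moment c v a t)) (W s t) : R3).
assert (Hvar : RInt (fun t => c t * Derive (fun u => gamma u t) 0 +
                      2 * dot (velocity v t) (velocity eta t)) a b = 0).
{ apply (first_variation x y a b eps gamma eta Y Hgeo Harc Hab Heps Hg Hg0 He Hperp Ha Hb).
  - apply strip_smooth3_plus; [|exact HW]; apply strip_smooth3_time.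
    apply smooth3_minus; [now apply smooth3_back with x|now apply smooth3_moment].
  - intro t; unfold Y; rewrite HW0; r3_ring.
  - intros s Hs; unfold Y; split.
    + rewrite HWa; unfold moment; rewrite RInt3_point; r3_ring.
    + unfold W; rewrite (Hclose s Hs); r3_ring.
  - intros s t _; unfold Y.
    replace (scal _ _) with
      (plus (minus (scal (c t) (v t)) (scal (c t) (v t)))
         (scal (gamma s t) (bend (eta t) (v t) s)) : R3) by (fold v; r3_ring).
    apply @is_derive_plus; [apply @is_derive_minus|apply HWd].
    + now apply is_derive_back.
    + now apply is_derive_moment. }
assert (Hbend : strip_smooth3 eps (fun s t => bend (eta t) (v t) s)).
{ unfold bend; apply strip_smooth3_plus; apply strip_smooth3_scal;
    try now apply strip_smooth3_time.
  - apply strip_smooth_minus; [apply strip_smooth_const|].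
    apply strip_smooth_mult; [apply strip_smooth_pow, strip_smooth_param|].
    apply strip_smooth_time; now apply smooth_dot.
  - apply strip_smooth_mult; [apply strip_smooth_const|apply strip_smooth_param]. }
pose (f s t := dot A (scal (gamma s t) (bend (eta t) (v t) s))).
assert (Hf : strip_smooth eps f).
{ apply (strip_smooth_dot eps (fun _ _ => A));
    [exact (strip_smooth3_time eps _ (smooth3_const A))|].
  now apply strip_smooth3_scal. }
assert (Hcon : RInt (fun t => Derive (fun u => f u t) 0) a b = 0).
{ apply constant_integral_derivative with eps (dot A (moment c v a b)); auto.
  intros s Hs.
  rewrite (RInt_derivative (fun t => dot A (W s t))).
  - rewrite HWa, dot_zero_r; unfold W; rewrite (Hclose s Hs); R_eq; ring.
  - intro t; pose proof (is_derive_dot (fun _ => A) (W s) t zero _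
      (is_derive_const A t) (HWd s t)) as H.
    cbv beta in H; rewrite dot_zero_l, Rplus_0_l in H; exact H.
  - now apply smooth_strip_slice with eps. }
assert (Hfd : forall t, Derive (fun u => f u t) 0 =
  Derive (fun u => gamma u t) 0 * dot A (v t) + 2 * (c t * dot A (eta t))).
{ intro t; apply is_derive_unique; unfold f.
  destruct (strip_smooth_derives _ _ Hg) as (_ & _ & Hgd).
  destruct (Hgd 0 t) as [Hgd0 _]; [now rewrite Rabs_R0|].
  assert (Hb0 : is_derive (fun s => dot A (bend (eta t) (v t) s)) 0 (2 * dot A (eta t))).
  { apply is_derive_quadratic with (dot A (v t)) (- dot (eta t) (eta t) * dot A (v t)).
    intro s; unfold bend; r3_ring. }
  apply is_derive_ext with (fun u => gamma u t * dot A (bend (eta t) (v t) u)).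
  { intro u; now rewrite dot_scal_r. }
  pose proof (is_derive_mult _ _ _ _ _ Hgd0 Hb0 Rmult_comm) as H.
  match type of H with is_derive _ _ ?l => replace (_ + _) with l; [exact H|] end.
  unfold plus, mult; simpl; rewrite Hg0.
  replace (bend (eta t) (v t) 0) with (v t) by (unfold bend; r3_ring).
  R_eq; ring. }
pose proof (smooth3_velocity _ Hv) as Hv'; pose proof (smooth3_velocity _ He) as He'.
assert (HAe : smooth (fun t => dot A (eta t))) by (apply smooth_dot; [apply smooth3_const|exact He]).
assert (HAv : smooth (fun t => dot A (v t))) by (apply smooth_dot; [apply smooth3_const|exact Hv]).
assert (Hgs : smooth (fun t => Derive (fun u => gamma u t) 0)).
{ apply (smooth_strip_slice eps (fun s t => Derive (fun u => gamma u t) s));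
    [apply strip_smooth_derives, Hg|now rewrite Rabs_R0]. }
apply Rmult_eq_reg_l with 2; [rewrite Rmult_0_r|lra].
match type of Hvar with ?I = _ => match type of Hcon with ?J = _ =>
  transitivity (I - J); [|rewrite Hvar, Hcon; R_eq; ring] end end.
rewrite <- smooth_RInt_minus.
- transitivity (RInt (fun t => 2 * (dot (velocity v t) (velocity eta t) - c t * dot A (eta t))) a b).
  + symmetry; apply (smooth_RInt_scal 2
      (fun t => dot (velocity v t) (velocity eta t) - c t * dot A (eta t))).
    apply smooth_minus; [now apply smooth_dot|now apply smooth_mult].
  + apply RInt_ext; intros t Ht; rewrite Rmin_left, Rmax_right in Ht by lra.
    rewrite Hfd, <- (HA t Ht); R_eq; ring.
- apply smooth_plus; [now apply smooth_mult|].
  apply smooth_mult; [apply smooth_const|now apply smooth_dot].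
- apply (smooth_strip_slice eps (fun s t => Derive (fun u => f u t) s));
    [apply strip_smooth_derives, Hf|now rewrite Rabs_R0].
Qed.

Lemma euler_lagrange_on x y a b A :
  bicycling_geodesic x y -> arc_length_parametrized x -> a < b ->
  spans_on (frame x y) a b ->
  (forall t, a < t < b -> back_speed x y t = dot A (frame x y t)) ->
  forall t, a < t < b -> velocity (velocity (frame x y)) t =
    plus (scal (2 * back_speed x y t ^ 2 - 1) (frame x y t))
         (scal (- back_speed x y t) A).
Proof.
intros Hgeo Harc Hab Hspan HA.
pose proof (proj1 Hgeo) as Hpath.
pose proof (fun t => frame_unit x y t Hpath) as Hvv.
pose proof (fun t => frame_speed x y t Hpath Harc) as Hspeed.
assert (Hv : smooth3 (frame x y)) by now apply smooth3_frame.
assert (Hc : smooth (back_speed x y)) by now apply smooth_back_speed.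
pose proof (frame_variation x y a b A) as Hcrit.
set (v := frame x y) in *; set (c := back_speed x y) in *.
pose proof (smooth3_velocity _ Hv) as Hv'; pose proof (smooth3_velocity _ Hv') as Hv''.
pose (G t := plus (velocity (velocity v) t) (scal (c t) A) : R3).
assert (HG : smooth3 G).
{ apply smooth3_plus; [exact Hv''|]. apply smooth3_scal; [exact Hc|apply smooth3_const]. }
pose (F t := minus (G t) (scal (dot (G t) (v t)) (v t)) : R3).
assert (HF : smooth3 F).
{ apply smooth3_minus; [exact HG|]. apply smooth3_scal; [now apply smooth_dot|exact Hv]. }
assert (HFv : forall t, dot (F t) (v t) = 0).
{ intro t; unfold F; rewrite dot_minus_l, dot_scal_l, Hvv; ring. }
(* The test field is F, the tangential defect of the equation, weighted to
   vanish at both ends. *)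
pose (bump t := (t - a) * (b - t)).
assert (Hbump : smooth bump).
{ apply smooth_mult; apply smooth_minus; apply smooth_id || apply smooth_const. }
pose (eta t := scal (bump t) (F t) : R3).
assert (He : smooth3 eta) by now apply smooth3_scal.
pose proof (smooth3_velocity _ He) as He'.
assert (HGF : RInt (fun t => bump t * dot (F t) (F t)) a b = 0).
{ specialize (Hcrit eta Hgeo Harc Hab Hspan HA He).
  assert (Hea : eta a = zero) by (unfold eta, bump; r3_ring).
  assert (Heb : eta b = zero) by (unfold eta, bump; r3_ring).
  assert (Hperp : forall t, dot (eta t) (v t) = 0).
  { intro t; unfold eta; rewrite dot_scal_l, HFv; ring. }
  specialize (Hcrit Hperp Hea Heb).
  assert (Hparts : RInt (fun t => dot (velocity (velocity v) t) (eta t)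
                     + dot (velocity v t) (velocity eta t)) a b = 0).
  { rewrite (RInt_derivative (fun t => dot (velocity v t) (eta t))).
    - rewrite Hea, Heb, !dot_zero_r; R_eq; ring.
    - intro t; apply is_derive_dot; now apply smooth3_is_derive.
    - apply smooth_plus; now apply smooth_dot. }
  match type of Hparts with ?I = _ => match type of Hcrit with ?J = _ =>
    transitivity (I - J); [|rewrite Hparts, Hcrit; R_eq; ring] end end.
  rewrite <- smooth_RInt_minus.
  - apply RInt_ext_everywhere; intro t.
    replace (dot (F t) (F t)) with (dot (F t) (G t)).
    + unfold eta, G; rewrite !dot_scal_r, dot_plus_r, dot_scal_r, (dot_comm (F t) A),
        (dot_comm (F t) (velocity _ _)); ring.
    + unfold F at 3; rewrite dot_minus_r, dot_scal_r, HFv; ring.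
  - apply smooth_plus; now apply smooth_dot.
  - apply smooth_minus; [now apply smooth_dot|].
    apply smooth_mult; [exact Hc|]. apply smooth_dot; [apply smooth3_const|exact He]. }
intros t Ht.
assert (HF0 : F t = zero).
{ apply dot_self_zero.
  assert (H : bump t * dot (F t) (F t) = 0).
  { apply (RInt_nonneg_zero (fun t => bump t * dot (F t) (F t)) a b Hab); auto.
    - apply smooth_mult; [exact Hbump|now apply smooth_dot].
    - intros u Hu; apply Rmult_le_pos; [unfold bump; nra|apply dot_self_pos]. }
  assert (0 < bump t) by (unfold bump; nra); nra. }
assert (Hvv' : forall t, dot (v t) (velocity v t) = 0) by now intro; apply unit_perp_velocity.
assert (Hvv'' : dot (velocity (velocity v) t) (v t) = c t ^ 2 - 1).
{ pose proof (is_derive_dot _ _ _ _ _ (smooth3_is_derive _ t Hv)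
    (smooth3_is_derive _ t Hv')) as H.
  apply is_derive_unique in H.
  rewrite (Derive_ext _ (fun _ => 0)), Derive_const in H by exact Hvv'.
  rewrite (dot_comm (v t)) in H; specialize (Hspeed t); lra. }
assert (HGv : dot (G t) (v t) = 2 * c t ^ 2 - 1).
{ unfold G; rewrite dot_plus_l, dot_scal_l, Hvv'', <- (HA t Ht); ring. }
assert (E : G t = scal (2 * c t ^ 2 - 1) (v t)).
{ rewrite <- HGv; transitivity (plus (F t) (scal (dot (G t) (v t)) (v t)) : R3).
  - unfold F; r3_ring.
  - rewrite HF0; r3_ring. }
rewrite <- E; unfold G; r3_ring.
Qed.

(** The vectors A found on different intervals coincide, because v spans on
    a common subinterval. *)
Theorem geodesic_equation x y :
  bicycling_geodesic x y -> arc_length_parametrized x -> ~ planar x ->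
  exists A, forall t,
    back_speed x y t = dot A (frame x y t) /\
    velocity (velocity (frame x y)) t =
      plus (scal (2 * back_speed x y t ^ 2 - 1) (frame x y t))
           (scal (- back_speed x y t) A).
Proof.
intros Hgeo Harc Hnp.
destruct (spans_on_interval (frame x y)
  (nonplanar_frame_spans x y (proj1 Hgeo) Hnp)) as (L & HL & Hspan).
destruct (back_speed_linear_on x y (- L) L) as [A HA]; auto; [lra|apply Hspan; lra|].
exists A; intro t.
pose (m := L + Rabs t).
pose proof (Rabs_pos t); pose proof (Rle_abs t); pose proof (Rle_abs (- t)).
rewrite Rabs_Ropp in *.
assert (Hs : spans_on (frame x y) (- m) m) by (apply Hspan; unfold m; lra).
destruct (back_speed_linear_on x y (- m) m) as [A' HA']; auto; [unfold m; lra|].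
assert (EA : A' = A).
{ assert (E : minus A' A = zero).
  { apply (Hspan (- L) L); [lra|lra|]; intros u Hu.
    rewrite dot_minus_l, <- HA, <- HA' by (unfold m; lra); ring. }
  replace A' with (plus A (minus A' A) : R3) by r3_ring; rewrite E; r3_ring. }
subst A'; split; [apply HA'; unfold m; lra|].
apply (euler_lagrange_on x y (- m) m A); auto; unfold m; lra.
Qed.

(** * Half-period symmetry of the speed of the back wheel *)

(** Gronwall: where |q| <= K, the function (f^2 + g^2) exp (- (1 + K) t) is
    nonincreasing. *)
Lemma linear_ode_zero_right (q f g : R -> R) t0 t1 : t0 <= t1 ->
  (forall t, is_derive f t (g t)) -> (forall t, is_derive g t (q t * f t)) ->
  (forall t, continuous q t) -> f t0 = 0 -> g t0 = 0 -> f t1 = 0.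
Proof.
intros Ht Hf Hg Hq Hf0 Hg0.
destruct (continuity_ab_maj (fun t => Rabs (q t)) t0 t1 Ht) as [m [Hm _]].
{ intros t _; apply continuity_pt_filterlim.
  apply (continuous_comp q Rabs); [apply Hq|apply continuous_Rabs]. }
cbv beta in Hm; set (K := Rabs (q m)) in *.
pose (h t := (f t ^ 2 + g t ^ 2) * exp (- (1 + K) * t)).
pose (dh t := (2 * f t * g t + 2 * g t * (q t * f t)
               - (1 + K) * (f t ^ 2 + g t ^ 2)) * exp (- (1 + K) * t)).
assert (Hh : forall t, is_derive h t (dh t)).
{ intro t; unfold h, dh; auto_derive.
  - repeat split; eexists; [apply Hf|apply Hg].
  - change (fun x => f x) with f; change (fun x => g x) with g.
    rewrite (is_derive_unique _ _ _ (Hf t)), (is_derive_unique _ _ _ (Hg t)); ring. }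
destruct (MVT_gen h t0 t1 dh) as [c [Hc E]].
- intros; apply Hh.
- intros; apply continuity_pt_filterlim, @ex_derive_continuous; eexists; apply Hh.
- rewrite Rmin_left, Rmax_right in Hc by lra.
  assert (Hdh : dh c <= 0).
  { unfold dh; pose proof (Hm c Hc) as HK; pose proof (exp_pos (- (1 + K) * c)).
    pose proof (Rle_abs (q c)); pose proof (Rle_abs (- q c)); rewrite Rabs_Ropp in *.
    assert (2 * f c * g c + 2 * g c * (q c * f c) - (1 + K) * (f c ^ 2 + g c ^ 2) <= 0).
    { assert (0 <= 1 + K) by (pose proof (Rabs_pos (q m)); unfold K; lra).
      assert (0 <= (f c - g c) ^ 2) by apply pow2_ge_0.
      assert (0 <= (f c + g c) ^ 2) by apply pow2_ge_0.
      assert (0 <= (K - q c) * (f c + g c) ^ 2) by (apply Rmult_le_pos; lra).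
      assert (0 <= (K + q c) * (f c - g c) ^ 2) by (apply Rmult_le_pos; lra).
      nra. }
    nra. }
  assert (Hle : h t1 <= 0).
  { assert (h t0 = 0) by (unfold h; rewrite Hf0, Hg0; ring). nra. }
  unfold h in Hle; pose proof (exp_pos (- (1 + K) * t1)).
  assert (0 <= f t1 ^ 2) by apply pow2_ge_0; assert (0 <= g t1 ^ 2) by apply pow2_ge_0.
  assert (f t1 ^ 2 + g t1 ^ 2 <= 0) by nra.
  apply Rsqr_0_uniq; unfold Rsqr; nra.
Qed.

Lemma linear_ode_zero (q f g : R -> R) t0 :
  (forall t, is_derive f t (g t)) -> (forall t, is_derive g t (q t * f t)) ->
  (forall t, continuous q t) -> f t0 = 0 -> g t0 = 0 -> forall t, f t = 0.
Proof.
intros Hf Hg Hq Hf0 Hg0 t; destruct (Rle_dec t0 t) as [Ht|Ht].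
- now apply linear_ode_zero_right with q g t0.
- replace (f t) with (f (- - t)) by (f_equal; ring).
  apply (linear_ode_zero_right (fun u => q (- u)) (fun u => f (- u))
    (fun u => - g (- u)) (- t0) (- t)); [lra| | | | |].
  + intro u; auto_derive; [eexists; apply Hf|].
    change (fun x => f x) with f; rewrite (is_derive_unique _ _ _ (Hf (- u))); ring.
  + intro u; auto_derive; [eexists; apply Hg|].
    change (fun x => g x) with g; rewrite (is_derive_unique _ _ _ (Hg (- u))); ring.
  + intro u; apply (continuous_comp Ropp q); [|apply Hq].
    apply @ex_derive_continuous; auto_derive; trivial.
  + now rewrite Ropp_involutive.
  + rewrite Ropp_involutive, Hg0; ring.
Qed.

Lemma period_not_constant T k : ~ is_period T (fun _ => k).
Proof.
intros [HT [_ Hmin]].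
assert (T <= T / 2) by (apply Hmin; [lra|intro; reflexivity]); lra.
Qed.

Lemma is_derive_shift (f : R -> R) a t l :
  is_derive f (t + a) l -> is_derive (fun u => f (u + a)) t l.
Proof.
intro H; auto_derive; [eexists; exact H|].
change (fun x => f x) with f; rewrite (is_derive_unique _ _ _ H); ring.
Qed.

Lemma is_derive_reflect (f : R -> R) a t l :
  is_derive f (a - t) l -> is_derive (fun u => f (a - u)) t (- l).
Proof.
intro H; auto_derive; [eexists; exact H|].
change (fun x => f x) with f; rewrite (is_derive_unique f (a + - t) l H); ring.
Qed.

Lemma periodic_Z f T (n : Z) : periodic T f -> periodic (IZR n * T) f.
Proof.
intro Hf.
assert (Hnat : forall (k : nat) t, f (t + INR k * T) = f t).
{ induction k as [|k IH]; intro t.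
  - f_equal; simpl; ring.
  - rewrite S_INR; replace (t + (INR k + 1) * T) with ((t + INR k * T) + T) by ring.
    rewrite Hf; apply IH. }
intro t; destruct (Z.le_gt_cases 0 n) as [Hn|Hn].
- rewrite <- (Z2Nat.id n Hn), <- INR_IZR_INZ; apply Hnat.
- assert (Hm : (0 <= - n)%Z) by lia.
  rewrite <- (Hnat (Z.to_nat (- n)) (t + IZR n * T)).
  rewrite INR_IZR_INZ, (Z2Nat.id _ Hm), opp_IZR; f_equal; ring.
Qed.

(** The remainder of S modulo T is again a period. *)
Lemma periods_multiple f T S :
  0 < T -> periodic T f -> (forall P, 0 < P -> periodic P f -> T <= P) ->
  periodic S f -> exists n : Z, S = IZR n * T.
Proof.
intros HT Hf Hmin HS.
exists (up (S / T) - 1)%Z.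
destruct (archimed (S / T)) as [H1 H2].
rewrite minus_IZR; set (k := IZR (up (S / T))) in *.
assert (E : S = S / T * T) by (field; lra).
assert (Hr : 0 <= S - (k - 1) * T < T) by (rewrite E; split; nra).
destruct (Req_dec (S - (k - 1) * T) 0) as [H0|H0]; [lra|].
assert (T <= S - (k - 1) * T); [|lra].
apply Hmin; [lra|].
intro t; replace (t + (S - (k - 1) * T)) with (t + S + IZR (1 - up (S / T)) * T)
  by (rewrite minus_IZR; fold k; ring).
rewrite periodic_Z by exact Hf; apply HS.
Qed.

(** The elliptic function w is anti-invariant under half of its period. The
    minimal period of w' + w^2 is that of w, since w is recovered from
    z = rho - 2 (w' + w^2) as z' / (2 z). *)
Lemma half_period (w d : R -> R) rho k0 T :
  (forall t, is_derive w t (d t)) ->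
  (forall t, is_derive d t (2 * w t ^ 3 - rho * w t)) ->
  is_period T (fun t => k0 - 2 * (d t + w t ^ 2)) ->
  antiperiodic (T / 2) w.
Proof.
intros Hw Hd Hper; pose proof Hper as (HT & HperT & Hmin).
assert (Cw : forall t, continuous w t)
  by (intro; apply @ex_derive_continuous; eexists; apply Hw).
assert (Cd : forall t, continuous d t)
  by (intro; apply @ex_derive_continuous; eexists; apply Hd).
(* z' = 2 w z is a linear equation, so z vanishes nowhere or identically. *)
pose (z t := rho - 2 * (d t + w t ^ 2)).
assert (Hz : forall t, is_derive z t (2 * w t * z t)).
{ intro t; unfold z; auto_derive.
  - repeat split; eexists; [apply Hd|apply Hw].
  - change (fun x => d x) with d; change (fun x => w x) with w.
    rewrite (is_derive_unique _ _ _ (Hw t)), (is_derive_unique _ _ _ (Hd t)); ring. }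
assert (HzT : periodic T z).
{ intro t; pose proof (HperT t) as H; cbv beta in H; unfold z; lra. }
assert (Hz0 : forall t, z t <> 0).
{ intros t0 E.
  apply (period_not_constant T (k0 - rho)).
  assert (Hzz : forall t, z t = 0).
  { apply (linear_ode_zero (fun t => 2 * d t + 4 * w t ^ 2) z (fun t => 2 * w t * z t) t0);
      [exact Hz| | |exact E|rewrite E; ring].
    - intro t; auto_derive.
      + repeat split; eexists; [apply Hw|apply Hz].
      + change (fun x => z x) with z; change (fun x => w x) with w.
        rewrite (is_derive_unique _ _ _ (Hw t)), (is_derive_unique _ _ _ (Hz t)); ring.
    - intro t; apply @ex_derive_continuous; auto_derive.
      repeat split; eexists; [apply Hd|apply Hw]. }
  split; [exact HT|split; [intro; reflexivity|]].
  intros S HS _; apply Hmin; [exact HS|]; intro t; cbv beta.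
  pose proof (Hzz t); pose proof (Hzz (t + S)); unfold z in *; lra. }
assert (HwT : periodic T w).
{ intro t; pose proof (is_derive_shift z T t _ (Hz (t + T))) as H1.
  assert (H2 : is_derive (fun u => z (u + T)) t (2 * w t * z t)).
  { apply is_derive_ext with z; [intro; symmetry; apply HzT|apply Hz]. }
  apply is_derive_unique in H1, H2; rewrite H1, HzT in H2.
  apply Rmult_eq_reg_r with (z t); [lra|apply Hz0]. }
assert (Hwmin : forall P, 0 < P -> periodic P w -> T <= P).
{ intros P HP HwP; apply Hmin; [exact HP|]; intro t; cbv beta.
  assert (E : d (t + P) = d t).
  { pose proof (is_derive_shift w P t _ (Hw (t + P))) as H1.
    assert (H2 : is_derive (fun u => w (u + P)) t (d t)).
    { apply is_derive_ext with w; [intro; symmetry; apply HwP|apply Hw]. }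
    apply is_derive_unique in H1, H2; congruence. }
  rewrite E, HwP; reflexivity. }
assert (Hrolle : forall f df : R -> R, (forall t, is_derive f t (df t)) ->
  periodic T f -> exists t, df t = 0).
{ intros f df Hf HfT; destruct (MVT_gen f 0 T df) as [c [_ E]].
  - intros; apply Hf.
  - intros; apply continuity_pt_filterlim, @ex_derive_continuous; eexists; apply Hf.
  - exists c; pose proof (HfT 0) as E'; rewrite Rplus_0_l in E'.
    apply Rmult_eq_reg_r with T; lra. }
destruct (Hrolle z _ Hz HzT) as [t0 H0].
(* The critical points of z are the zeros of w. *)
assert (Hw0 : w t0 = 0).
{ apply Rmult_integral in H0; destruct H0 as [H0|H0]; [lra|].
  now apply Hz0 in H0. }
destruct (Hrolle w d Hw HwT) as [t1 Hd1].
assert (Codd : forall a t, is_derive (fun u => w (a - u)) t (- d (a - t))).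
{ intros a t; apply is_derive_reflect, Hw. }
assert (Codd' : forall a t, is_derive (fun u => - d (a - u)) t
                        (2 * w (a - t) ^ 3 - rho * w (a - t))).
{ intros a t; rewrite <- (Ropp_involutive (2 * _ - _)).
  apply @is_derive_opp, is_derive_reflect, Hd. }
assert (Hodd : forall t, w (2 * t0 - t) = - w t).
{ intro t; cut (w (2 * t0 - t) + w t = 0); [lra|].
  apply (linear_ode_zero (fun t => 2 * (w (2 * t0 - t) ^ 2 - w (2 * t0 - t) * w t + w t ^ 2) - rho)
    (fun t => w (2 * t0 - t) + w t) (fun t => - d (2 * t0 - t) + d t) t0).
  - intro u; apply @is_derive_plus; [apply Codd|apply Hw].
  - intro u.
    match goal with |- is_derive _ _ ?l => replace l with ((2 * w (2 * t0 - u) ^ 3 - rho * w (2 * t0 - u)) +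
      (2 * w u ^ 3 - rho * w u)) by ring end.
    apply @is_derive_plus; [apply Codd'|apply Hd].
  - intro u; apply @ex_derive_continuous; auto_derive.
    repeat split; eexists; apply Hw.
  - replace (2 * t0 - t0) with t0 by ring; lra.
  - replace (2 * t0 - t0) with t0 by ring; lra. }
assert (Heven : forall t, w (2 * t1 - t) = w t).
{ intro t; cut (w (2 * t1 - t) - w t = 0); [lra|].
  apply (linear_ode_zero (fun t => 2 * (w (2 * t1 - t) ^ 2 + w (2 * t1 - t) * w t + w t ^ 2) - rho)
    (fun t => w (2 * t1 - t) - w t) (fun t => - d (2 * t1 - t) - d t) t1).
  - intro u; apply @is_derive_minus; [apply Codd|apply Hw].
  - intro u.
    match goal with |- is_derive _ _ ?l => replace l with ((2 * w (2 * t1 - u) ^ 3 - rho * w (2 * t1 - u)) -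
      (2 * w u ^ 3 - rho * w u)) by ring end.
    apply @is_derive_minus; [apply Codd'|apply Hd].
  - intro u; apply @ex_derive_continuous; auto_derive.
    repeat split; eexists; apply Hw.
  - replace (2 * t1 - t1) with t1 by ring; lra.
  - replace (2 * t1 - t1) with t1 by ring; rewrite Hd1; lra. }
(* Translation by D is the reflection about t0 followed by that about t1. *)
pose (D := 2 * t1 - 2 * t0).
assert (HD : antiperiodic D w).
{ intro t; replace (t + D) with (2 * t1 - (2 * t0 - t)) by (unfold D; ring).
  rewrite Heven; apply Hodd. }
destruct (periods_multiple w T (2 * D) HT HwT Hwmin) as [n Hn].
{ intro t; replace (t + 2 * D) with (t + D + D) by ring; rewrite !HD; ring. }
destruct (Z.Even_or_Odd n) as [[m Hm]|[m Hm]]; subst n.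
- (* Then D is itself a period of w, so w = -w. *)
  exfalso; apply (period_not_constant T k0).
  assert (Hw00 : forall t, w t = 0).
  { intro t; pose proof (HD t) as E.
    replace D with (IZR m * T) in E by (rewrite mult_IZR in Hn; lra).
    rewrite periodic_Z in E by exact HwT; lra. }
  assert (Hd00 : forall t, d t = 0).
  { intro t; rewrite <- (is_derive_unique _ _ _ (Hw t)).
    rewrite (Derive_ext _ (fun _ => 0) t Hw00); apply Derive_const. }
  split; [exact HT|split; [intro; reflexivity|]].
  intros S HS _; apply Hmin; [exact HS|]; intro t; cbv beta.
  now rewrite !Hw00, !Hd00.
- intro t; rewrite <- (periodic_Z w T m HwT (t + T / 2)).
  replace (t + T / 2 + IZR m * T) with (t + D); [apply HD|].
  rewrite plus_IZR, mult_IZR in Hn; lra.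
Qed.

(** * Rotations and screw motions *)

(** The linear part of Rodrigues' formula, with the cosine C and the sine S as
    independent arguments so that identities are polynomial. *)
Definition turn (e : R3) (C S : R) (p : R3) : R3 :=
  plus (scal C p) (plus (scal S (cross e p)) (scal ((1 - C) * dot e p) e)).

Lemma turn_plus e C S p q :
  turn e C S (plus p q) = plus (turn e C S p) (turn e C S q).
Proof. unfold turn; r3_ring. Qed.

Lemma turn_minus e C S p q :
  turn e C S (minus p q) = minus (turn e C S p) (turn e C S q).
Proof. unfold turn; r3_ring. Qed.

Lemma dot_turn_transpose e C S n p :
  dot n (turn e C S p) = dot (turn e C (- S) n) p.
Proof. unfold turn; r3_ring. Qed.

Lemma dot_cross_cross e p q :
  dot (cross e p) (cross e q) = dot e e * dot p q - dot e p * dot e q.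
Proof. r3_ring. Qed.

Lemma dot_axis_turn e C S p : dot e e = 1 -> dot e (turn e C S p) = dot e p.
Proof.
intro He; unfold turn; rewrite !dot_plus_r, !dot_scal_r, He.
replace (dot e (cross e p)) with 0 by r3_ring; ring.
Qed.

Lemma turn_axis e C S (k : R) : dot e e = 1 -> turn e C S (scal k e) = scal k e.
Proof.
intro He; unfold turn.
replace (cross e (scal k e)) with (zero : R3) by r3_ring.
rewrite dot_scal_r, He; r3_ring.
Qed.

Lemma dot_turn_turn e C S p q : dot e e = 1 ->
  dot (turn e C S p) (turn e C S q) =
  (C ^ 2 + S ^ 2) * (dot p q - dot e p * dot e q) + dot e p * dot e q.
Proof.
intro He; unfold turn.
rewrite !dot_plus_l, !dot_plus_r, !dot_scal_l, !dot_scal_r, dot_cross_cross, He.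
replace (dot (cross e p) e) with 0 by r3_ring.
replace (dot e (cross e q)) with 0 by r3_ring.
replace (dot (cross e p) q) with (- dot p (cross e q)) by r3_ring.
rewrite (dot_comm p e); ring.
Qed.

Lemma cross_axis_turn e C S p : dot e e = 1 ->
  cross e (turn e C S p) = turn e C S (cross e p).
Proof.
intro He; unfold turn.
replace (dot e (cross e p)) with 0 by r3_ring.
r3_ring.
Qed.

Lemma cross_cross_axis e p :
  cross e (cross e p) = minus (scal (dot e p) e) (scal (dot e e) p).
Proof. r3_ring. Qed.

Lemma turn_turn e C S C' S' p : dot e e = 1 ->
  turn e C S (turn e C' S' p) = turn e (C * C' - S * S') (S * C' + C * S') p.
Proof.
intro He; unfold turn at 1 3.
rewrite dot_axis_turn, cross_axis_turn by exact He; unfold turn.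
replace (dot e (cross e p)) with 0 by r3_ring.
rewrite cross_cross_axis, He; r3_ring.
Qed.

(** C and S are read off from the projections of p and q to the plane
    perpendicular to e, which are nonzero and of equal length. *)
Lemma turn_exists e p q : dot e e = 1 -> dot e p = dot e q -> dot p p = dot q q ->
  cross e p <> zero ->
  exists C S, C ^ 2 + S ^ 2 = 1 /\ turn e C S p = q.
Proof.
intros He Hpq Hnorm Hne.
pose (m := dot (cross e p) (cross e p)).
assert (Hm : m <> 0) by (intro E; apply Hne, dot_self_zero, E).
assert (Em : m = dot p p - dot e p ^ 2)
  by (unfold m; rewrite dot_cross_cross, He; ring).
pose (C := (dot p q - dot e p ^ 2) / m); pose (S := dot (cross e p) q / m).
assert (E : turn e C S p = q).
{ assert (E0 : minus (turn e C S p) q = zero).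
  { apply (perp_det_zero e p (cross e p)).
    - replace (det e p (cross e p)) with m by (unfold m, det; r3_ring); exact Hm.
    - rewrite dot_comm, dot_minus_r, dot_axis_turn by exact He; lra.
    - rewrite dot_minus_l; unfold turn.
      rewrite !dot_plus_l, !dot_scal_l.
      replace (dot (cross e p) p) with 0 by r3_ring.
      replace (C * dot p p) with (C * m + C * dot e p ^ 2) by (rewrite Em; ring).
      rewrite (dot_comm q p); unfold C; field; exact Hm.
    - rewrite dot_minus_l; unfold turn.
      rewrite !dot_plus_l, !dot_scal_l; fold m.
      replace (dot p (cross e p)) with 0 by r3_ring.
      replace (dot e (cross e p)) with 0 by r3_ring.
      rewrite (dot_comm q); unfold S; field; exact Hm. }
  transitivity (plus q (minus (turn e C S p) q) : R3); [r3_ring|].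
  rewrite E0; r3_ring. }
exists C, S; split; [|exact E].
pose proof (dot_turn_turn e C S p p He) as H; rewrite E, <- Hnorm in H.
apply Rmult_eq_reg_r with m; [|exact Hm]; rewrite Em; lra.
Qed.

(** The vectors e, q and e x q form a basis, and the hypotheses say that the
    rotated p' and q' have the same inner products with it. *)
Lemma turn_velocity e C S p q p' q' : dot e e = 1 -> C ^ 2 + S ^ 2 = 1 ->
  turn e C S p = q -> cross e p <> zero ->
  dot e p' = dot e q' -> dot p p' = dot q q' ->
  dot (cross e p) p' = dot (cross e q) q' ->
  turn e C S p' = q'.
Proof.
intros He HCS E Hne H1 H2 H3.
pose (m := dot (cross e p) (cross e p)).
assert (Hm : m <> 0) by (intro E0; apply Hne, dot_self_zero, E0).
assert (Eq : cross e q = turn e C S (cross e p))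
  by (rewrite <- E; now apply cross_axis_turn).
assert (E0 : minus (turn e C S p') q' = zero).
{ apply (perp_det_zero e q (cross e q)).
  - replace (det e q (cross e q)) with (dot (cross e q) (cross e q))
      by (unfold det; r3_ring).
    rewrite Eq, dot_turn_turn, HCS by exact He; fold m.
    intro E1; apply Hm; lra.
  - rewrite dot_comm, dot_minus_r, dot_axis_turn by exact He; lra.
  - rewrite dot_comm, dot_minus_r, <- H2, <- E, dot_turn_turn, HCS by exact He; ring.
  - rewrite dot_comm, dot_minus_r, <- H3, Eq, dot_turn_turn, HCS by exact He; ring. }
transitivity (plus q' (minus (turn e C S p') q') : R3); [r3_ring|].
rewrite E0; r3_ring.
Qed.

Lemma angle_exists C S : C ^ 2 + S ^ 2 = 1 -> exists theta, cos theta = C /\ sin theta = S.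
Proof.
intro H.
assert (HC : -1 <= C <= 1) by nra.
assert (Hs : sin (acos C) = sqrt (S ^ 2)).
{ rewrite sin_acos by exact HC; f_equal; unfold Rsqr; lra. }
destruct (Rle_dec 0 S) as [HS|HS].
- exists (acos C); split; [now apply cos_acos|].
  rewrite Hs; now apply sqrt_pow2.
- exists (- acos C); rewrite cos_neg, sin_neg; split; [now apply cos_acos|].
  rewrite Hs; replace (S ^ 2) with ((- S) ^ 2) by ring.
  rewrite sqrt_pow2 by lra; ring.
Qed.

Lemma rotation_turn c e theta p :
  rotation c e theta p = plus c (turn e (cos theta) (sin theta) (minus p c)).
Proof. reflexivity. Qed.

(** The part of k along e is the translation of the screw; the part kp
    perpendicular to e is absorbed by moving the axis to a fixed point of
    p |-> R p + kp. *)
Lemma turn_translation_screw e C S k : dot e e = 1 -> C ^ 2 + S ^ 2 = 1 ->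
  exists c e', screw_motion_about c e' (fun p => plus (turn e C S p) k).
Proof.
intros He HCS.
destruct (Req_dec C 1) as [HC|HC].
- (* A translation: any line parallel to k is an axis, and for k = 0 any line. *)
  assert (HS : S = 0) by nra.
  assert (Hid : forall p, turn e C S p = p) by (intro; unfold turn; rewrite HC, HS; r3_ring).
  assert (Hk : exists h e', dot e' e' = 1 /\ k = scal h e').
  { destruct (classic (k = zero)) as [->|Hk]; [|now apply normalize_unit].
    exists 0, e; split; [exact He|r3_ring]. }
  destruct Hk as (h & e' & He' & Hk).
  exists zero, e'; split; [now apply norm_one|].
  exists 0, h; intro p; rewrite Hid, rotation_turn, cos_0, sin_0, Hk.
  unfold turn; r3_ring.
- pose (h := dot e k); pose (kp := minus k (scal h e) : R3).
  destruct (angle_exists C S HCS) as (theta & Hcos & Hsin).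
  (* S / (1 - C) is the cotangent of half the angle, and c is the inverse of
     1 - R, restricted to the plane perpendicular to e, applied to kp. *)
  pose (cot := S / (1 - C)).
  assert (H1 : (1 - C) * cot = S) by (unfold cot; field; lra).
  assert (H2 : S * cot = 1 + C).
  { apply Rmult_eq_reg_l with (1 - C); [|lra].
    replace ((1 - C) * (S * cot)) with (S * ((1 - C) * cot)) by ring.
    rewrite H1; lra. }
  assert (Hekp : dot e kp = 0)
    by (unfold kp, h; rewrite dot_minus_r, dot_scal_r, He; ring).
  pose (c := scal (/ 2) (plus kp (scal cot (cross e kp))) : R3).
  assert (Hec : dot e c = 0).
  { unfold c; rewrite dot_scal_r, dot_plus_r, dot_scal_r, Hekp.
    replace (dot e (cross e kp)) with 0 by r3_ring; ring. }
  assert (Hcc : cross e c = scal (/ 2) (minus (cross e kp) (scal cot kp))).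
  { transitivity (scal (/ 2) (plus (cross e kp) (scal cot (cross e (cross e kp)))) : R3).
    - unfold c; r3_ring.
    - rewrite cross_cross_axis, He, Hekp; r3_ring. }
  assert (Hc : minus c (turn e C S c) = kp).
  { transitivity (plus (scal (/ 2 * ((1 - C) + S * cot)) kp)
      (scal (/ 2 * ((1 - C) * cot - S)) (cross e kp)) : R3).
    - unfold turn; rewrite Hec, Hcc; unfold c; r3_ring.
    - rewrite H1, H2; apply R3_ext; autorewrite with coords; R_eq; field. }
  exists c, e; split; [now apply norm_one|].
  exists theta, h; intro p; rewrite rotation_turn, Hcos, Hsin, turn_minus.
  transitivity (plus (plus (turn e C S p) kp) (scal h e) : R3).
  + unfold kp; r3_ring.
  + rewrite <- Hc; r3_ring.
Qed.

Lemma screw_motion_square c e J M :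
  screw_motion_about c e J -> (forall p, J (J p) = M p) -> screw_motion_about c e M.
Proof.
intros [He (theta & h & HJ)] HM; split; [exact He|].
exists (theta + theta), (h + h); intro p.
apply norm_one in He.
rewrite <- HM, !HJ, !rotation_turn, cos_plus, sin_plus, <- turn_turn by exact He.
set (q := turn e (cos theta) (sin theta) (minus p c)).
replace (minus (plus (plus c q) (scal h e)) c) with (plus q (scal h e) : R3) by r3_ring.
rewrite turn_plus, turn_axis by exact He; r3_ring.
Qed.

Lemma screw_motion_isometry c e J : screw_motion_about c e J -> isometry J.
Proof.
intros [He (theta & h & HJ)] p q; apply norm_one in He.
rewrite !norm_R3, !HJ, !rotation_turn; f_equal.
replace (minus (plus _ _) _) with (turn e (cos theta) (sin theta) (minus p q)).
- rewrite dot_turn_turn by exact He.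
  pose proof (sin2_cos2 theta) as H; unfold Rsqr in H.
  replace (cos theta ^ 2 + sin theta ^ 2) with 1 by lra; ring.
- replace (minus p q) with (minus (minus p c) (minus q c) : R3) by r3_ring.
  rewrite turn_minus; r3_ring.
Qed.

(** If F p and G p differ, every point of the curve is equidistant from them,
    hence lies in their bisecting plane. *)
Lemma isometries_agree (F G : R3 -> R3) (z : R -> R3) :
  isometry F -> isometry G -> ~ planar (fun t => G (z t)) ->
  (forall t, F (z t) = G (z t)) -> forall p, F p = G p.
Proof.
intros HF HG Hnp HFG p; apply NNPP; intro Hne; apply Hnp.
pose (n := minus (F p) (G p) : R3).
exists n, ((dot (F p) (F p) - dot (G p) (G p)) / 2); split.
- intro E; apply Hne.
  transitivity (plus (G p) n : R3); [unfold n; r3_ring|]. rewrite E; r3_ring.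
- intro t; pose proof (HF p (z t)) as H1; pose proof (HG p (z t)) as H2.
  rewrite HFG in H1; rewrite <- H2, !norm_R3 in H1.
  apply sqrt_inj in H1; try apply dot_self_pos.
  rewrite !dot_minus_l, !dot_minus_r, (dot_comm (G (z t)) (F p)),
    (dot_comm (G (z t)) (G p)) in H1.
  unfold n; rewrite dot_minus_l; lra.
Qed.

(** * The monodromy of a bicycling geodesic *)

(** The first integrals |v| = 1 and |v'|^2 = 1 - (A.v)^2 are part of the
    definition: they express the unit length of the frame and of x'. *)
Definition frame_equation (A : R3) (v : R -> R3) : Prop :=
  smooth3 v /\ (forall t, dot (v t) (v t) = 1) /\
  (forall t, dot (velocity v t) (velocity v t) = 1 - dot A (v t) ^ 2) /\
  forall t, is_derive (velocity v) t
    (plus (scal (2 * dot A (v t) ^ 2 - 1) (v t)) (scal (- dot A (v t)) A)).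

Lemma geodesic_frame_equation x y :
  bicycling_geodesic x y -> arc_length_parametrized x -> ~ planar x ->
  exists A, frame_equation A (frame x y) /\
    forall t, is_derive y t (scal (dot A (frame x y t)) (frame x y t)).
Proof.
intros Hgeo Harc Hnp; destruct (geodesic_equation x y Hgeo Harc Hnp) as [A HA].
pose proof (proj1 Hgeo) as Hpath; pose proof (smooth3_frame _ _ Hpath) as Hv.
exists A; split; [split; [exact Hv|split; [|split]]|].
- intro t; now apply frame_unit.
- intro t; rewrite <- (proj1 (HA t)), <- (frame_speed x y t Hpath Harc); ring.
- intro t; rewrite <- (proj1 (HA t)), <- (proj2 (HA t)).
  now apply smooth3_is_derive, smooth3_velocity.
- intro t; rewrite <- (proj1 (HA t)); now apply is_derive_back.
Qed.

Lemma is_derive_dot_frame A v t : frame_equation A v ->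
  is_derive (fun t => dot A (v t)) t (dot A (velocity v t)).
Proof. intro Hv; apply is_derive_dot_const, smooth3_is_derive, Hv. Qed.

Lemma is_derive_dot_frame_velocity A v t : frame_equation A v ->
  is_derive (fun t => dot A (velocity v t)) t
    (2 * dot A (v t) ^ 3 - (1 + dot A A) * dot A (v t)).
Proof.
intro Hv.
replace (2 * _ - _) with (dot A
  (plus (scal (2 * dot A (v t) ^ 2 - 1) (v t)) (scal (- dot A (v t)) A)))
  by (rewrite dot_plus_r, !dot_scal_r; ring).
apply is_derive_dot_const, Hv.
Qed.

Lemma energy_const (w d : R -> R) rho :
  (forall t, is_derive w t (d t)) ->
  (forall t, is_derive d t (2 * w t ^ 3 - rho * w t)) ->
  forall t s, d t ^ 2 - w t ^ 4 + rho * w t ^ 2 = d s ^ 2 - w s ^ 4 + rho * w s ^ 2.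
Proof.
intros Hw Hd.
apply (is_derive_zero_const (fun t => d t ^ 2 - w t ^ 4 + rho * w t ^ 2)).
intro t; auto_derive.
- repeat split; eexists; [apply Hd|apply Hw|apply Hw].
- change (fun x => d x) with d; change (fun x => w x) with w.
  rewrite (is_derive_unique _ _ _ (Hw t)), (is_derive_unique _ _ _ (Hd t)); ring.
Qed.

(** The force v'' is a combination of v and A. *)
Lemma angular_momentum_const A v t s : frame_equation A v ->
  dot (cross A (v t)) (velocity v t) = dot (cross A (v s)) (velocity v s).
Proof.
intros (Hv & _ & _ & Hv'').
apply (is_derive_zero_const (fun t => dot (cross A (v t)) (velocity v t))).
clear t s; intro t.
pose proof (is_derive_dot _ _ _ _ _ (is_derive_cross A v t _ (smooth3_is_derive v t Hv))
  (Hv'' t)) as H.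
match type of H with is_derive _ _ ?l => replace 0 with l; [exact H|] end.
rewrite dot_plus_r, !dot_scal_r.
replace (dot (cross A (v t)) (v t)) with 0 by r3_ring.
replace (dot (cross A (v t)) A) with 0 by r3_ring.
replace (dot (cross A (velocity v t)) (velocity v t)) with 0 by r3_ring.
ring.
Qed.

(** Computing |x''|^2 from x' = w v + v' gives a quadratic expression in w, w'
    in which the energy w'^2 - w^4 + (1 + |A|^2) w^2 is a constant. *)
Lemma curvature_sq x y kappa A : bicycle_path x y -> is_curvature x kappa ->
  frame_equation A (frame x y) ->
  (forall t, is_derive y t (scal (dot A (frame x y t)) (frame x y t))) ->
  exists k0, forall t, kappa t ^ 2 =
    k0 - 2 * (dot A (velocity (frame x y) t) + dot A (frame x y t) ^ 2).
Proof.
intros Hpath (Tn & N & B & tau & _ & _ & _ & _ & _ & HF) Hfe Hy.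
set (v := frame x y) in *.
pose (w t := dot A (v t)); pose (d t := dot A (velocity v t)).
exists (1 + (d 0 ^ 2 - w 0 ^ 4 + (1 + dot A A) * w 0 ^ 2)); intro t.
pose proof Hfe as (Hv & Hvv & Hvv' & Hv'').
rewrite <- (energy_const w d (1 + dot A A) (fun t => is_derive_dot_frame A v t Hfe)
  (fun t => is_derive_dot_frame_velocity A v t Hfe) t 0).
assert (HT : forall u, plus (scal (w u) (v u)) (velocity v u) = Tn u).
{ intro u; rewrite <- (velocity_unique x u (Tn u) (proj1 (HF u))); symmetry.
  apply velocity_unique, is_derive_ext with (fun u => plus (y u) (v u)).
  - intro; symmetry; apply front_eq.
  - apply @is_derive_plus; [apply Hy|]. now apply smooth3_is_derive. }
destruct (HF t) as (_ & _ & HN & _ & _ & HTd & _).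
assert (E : scal (kappa t) (N t) =
  plus (plus (scal (d t) (v t)) (scal (w t) (velocity v t)))
    (plus (scal (2 * w t ^ 2 - 1) (v t)) (scal (- w t) A))).
{ rewrite <- (velocity_unique _ _ _ HTd).
  apply velocity_unique, is_derive_ext with (1 := HT).
  apply @is_derive_plus; [|apply Hv''].
  apply is_derive_scal_R3; [now apply is_derive_dot_frame|now apply smooth3_is_derive]. }
replace (kappa t ^ 2) with (dot (scal (kappa t) (N t)) (scal (kappa t) (N t))).
2:{ rewrite dot_scal_l, dot_scal_r, (proj1 (norm_one _) HN); ring. }
rewrite E, !dot_plus_l, !dot_plus_r, !dot_scal_l, !dot_scal_r.
rewrite (dot_comm (velocity v t) (v t)), (unit_perp_velocity v t Hv Hvv), Hvv, Hvv'.
rewrite (dot_comm (v t) A), (dot_comm (velocity v t) A); fold (w t) (d t); ring.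
Qed.

(** With w = A.v, the curves v(t) and -v(t + T/2) both solve the linear equation
    u'' = (2 w^2 - 1) u - w A, which rotations about A preserve; so they need
    only be matched at one instant, where v is not parallel to A. The conserved angular momentum
    about A is what matches the velocities. *)
Lemma frame_half_period_rotation A v T :
  frame_equation A v -> A <> zero ->
  (forall n, (forall t, dot n (v t) = 0) -> n = zero) ->
  antiperiodic (T / 2) (fun t => dot A (v t)) ->
  exists e C S, dot e e = 1 /\ C ^ 2 + S ^ 2 = 1 /\
    forall t, turn e C S (v t) = opp (v (t + T / 2)).
Proof.
intros Hfe HA0 Hspan Hanti; pose proof Hfe as (Hv & Hvv & Hvv' & Hv'').
set (h := T / 2) in *.
destruct (normalize_unit A HA0) as (k & e & He & HAe).
assert (Hk : k <> 0).
{ intro Hk; apply HA0; rewrite HAe, Hk; r3_ring. }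
assert (Ht0 : exists t0, cross e (v t0) <> zero).
{ apply NNPP; intro H.
  destruct (nonzero_perp e) as [n [Hn Hne]]; apply Hn, Hspan; intro t.
  apply cross_zero_perp with e.
  - intro E; rewrite E, dot_zero_l in He; lra.
  - apply NNPP; intro Hc; apply H; now exists t.
  - exact Hne. }
destruct Ht0 as [t0 Ht0].
assert (Hevel : forall t, dot A (velocity v (t + h)) = - dot A (velocity v t)).
{ intro t.
  pose proof (is_derive_shift (fun t => dot A (v t)) h t _ (is_derive_dot_frame A v (t + h) Hfe)) as H1.
  assert (H2 : is_derive (fun u => dot A (v (u + h))) t (- dot A (velocity v t))).
  { apply is_derive_ext with (fun u => - dot A (v u)).
    - intro u; symmetry; apply Hanti.
    - apply @is_derive_opp; now apply is_derive_dot_frame. }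
  apply is_derive_unique in H1, H2; rewrite <- H1; exact H2. }
assert (He_of_A : forall p q, dot A p = - dot A q -> dot e p = - dot e q).
{ intros p q E; rewrite HAe, !dot_scal_l in E.
  apply Rmult_eq_reg_l with k; lra. }
destruct (turn_exists e (v t0) (opp (v (t0 + h)))) as (C & S & HCS & Hturn).
- exact He.
- transitivity (- dot e (v (t0 + h))); [|r3_ring].
  rewrite (He_of_A (v (t0 + h)) (v t0)) by apply Hanti; ring.
- transitivity (dot (v (t0 + h)) (v (t0 + h))); [|r3_ring]. now rewrite !Hvv.
- exact Ht0.
- assert (Hturn' : turn e C S (velocity v t0) = opp (velocity v (t0 + h))).
  { apply (turn_velocity e C S (v t0) (opp (v (t0 + h)))); auto.
    - transitivity (- dot e (velocity v (t0 + h))); [|r3_ring].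
      rewrite (He_of_A (velocity v (t0 + h)) (velocity v t0)) by apply Hevel; ring.
    - transitivity (dot (v (t0 + h)) (velocity v (t0 + h))); [|r3_ring].
      now rewrite !unit_perp_velocity.
    - transitivity (dot (cross e (v (t0 + h))) (velocity v (t0 + h))); [|r3_ring].
      pose proof (angular_momentum_const A v t0 (t0 + h) Hfe) as E.
      rewrite HAe in E.
      replace (cross (scal k e) (v t0)) with (scal k (cross e (v t0)) : R3) in E by r3_ring.
      replace (cross (scal k e) (v (t0 + h))) with (scal k (cross e (v (t0 + h))) : R3)
        in E by r3_ring.
      rewrite !dot_scal_l in E; apply Rmult_eq_reg_l with k; assumption. }
  exists e, C, S; split; [exact He|split; [exact HCS|]].
  (* Testing against n moves the rotation to the constant vector n', so that only
     a scalar equation has to be solved. *)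
  intro t; apply R3_ext_dot; intro n.
  cut (dot (turn e C (- S) n) (v t) + dot n (v (t + h)) = 0).
  { rewrite dot_turn_transpose; replace (dot n (opp _)) with (- dot n (v (t + h))) by r3_ring.
    lra. }
  pose (n' := turn e C (- S) n); fold n'.
  assert (Hn'A : dot n' A = dot n A).
  { unfold n'; rewrite <- dot_turn_transpose, HAe, turn_axis; auto. }
  apply (linear_ode_zero (fun t => 2 * dot A (v t) ^ 2 - 1)
    (fun t => dot n' (v t) + dot n (v (t + h)))
    (fun t => dot n' (velocity v t) + dot n (velocity v (t + h))) t0).
  + intro u; apply @is_derive_plus.
    * apply is_derive_dot_const; now apply smooth3_is_derive.
    * apply (is_derive_shift (fun u => dot n (v u))).
      apply is_derive_dot_const; now apply smooth3_is_derive.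
  + intro u.
    pose proof (is_derive_dot_const n' _ _ _ (Hv'' u)) as H1.
    pose proof (is_derive_shift _ h u _ (is_derive_dot_const n _ _ _ (Hv'' (u + h)))) as H2.
    pose proof (is_derive_plus _ _ _ _ _ H1 H2) as H.
    match type of H with is_derive _ _ ?l =>
      match goal with |- is_derive _ _ ?r => replace r with l; [exact H|] end end.
    rewrite !dot_plus_r, !dot_scal_r, Hn'A.
    replace (dot A (v (u + h))) with (- dot A (v u)) by (symmetry; apply Hanti).
    unfold plus; simpl; R_eq; ring.
  + intro u; apply smooth_continuous.
    apply smooth_minus; [apply smooth_mult; [apply smooth_const|]|apply smooth_const].
    apply smooth_pow, smooth_dot; [apply smooth3_const|exact Hv].
  + unfold n'; rewrite <- dot_turn_transpose, Hturn; r3_ring.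
  + unfold n'; rewrite <- dot_turn_transpose, Hturn'; r3_ring.
Qed.

Theorem proposition3p14
  (x y : R -> R3) (kappa : R -> R) (T : R) (M : R3 -> R3)
  (Hgeodesic : bicycling_geodesic x y)
  (Hnonplanar : ~ planar x)
  (Harc : arc_length_parametrized x)
  (Hkappa : is_curvature x kappa)
  (HT : is_period T (fun t => kappa t ^ 2))
  (Hperiodic : periodic T kappa \/ antiperiodic T kappa)
  (HM : is_monodromy x y T M) :
  let v := fun t => minus (x t) (y t) in
  let x' := fun t => fst (bicycle_correspondence (x t, v t)) in
  exists J : R3 -> R3,
    (exists c e : R3, screw_motion_about c e J /\ screw_motion_about c e M) /\
    (forall t, x' (t + T / 2) = J (x t) /\ y (t + T / 2) = J (y t)) /\
    (forall p, J (J p) = M p).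
Proof.
intros v x'; change v with (frame x y) in *.
pose proof (proj1 Hgeodesic) as Hpath.
destruct (geodesic_frame_equation x y Hgeodesic Harc Hnonplanar) as (A & Hfe & Hy).
destruct (curvature_sq x y kappa A Hpath Hkappa Hfe Hy) as [k0 Hk0].
pose proof (nonplanar_frame_spans x y Hpath Hnonplanar) as Hspan.
set (u := frame x y) in *; set (h := T / 2) in *.
assert (HT' : is_period T (fun t => k0 - 2 * (dot A (velocity u t) + dot A (u t) ^ 2))).
{ destruct HT as (H1 & H2 & H3); split; [exact H1|split].
  - intro t; cbv beta; rewrite <- !Hk0; apply H2.
  - intros S HS HSp; apply H3; [exact HS|]; intro t; cbv beta; rewrite !Hk0; apply HSp. }
assert (Hanti : antiperiodic h (fun t => dot A (u t))).
{ apply (half_period _ _ _ k0 T (fun t => is_derive_dot_frame A u t Hfe)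
    (fun t => is_derive_dot_frame_velocity A u t Hfe) HT'). }
assert (HA0 : A <> zero).
{ intro E; apply (period_not_constant T k0).
  destruct HT' as (H1 & H2 & H3); split; [exact H1|split; [intro; reflexivity|]].
  intros S HS _; apply H3; [exact HS|]; intro t; cbv beta.
  rewrite E, !dot_zero_l; reflexivity. }
destruct (frame_half_period_rotation A u T Hfe HA0 Hspan Hanti)
  as (e & C & S & He & HCS & Hturn); fold h in Hturn.
pose (k := minus (y h) (turn e C S (y 0)) : R3).
pose (J p := plus (turn e C S p) k : R3).
assert (HJy : forall t, y (t + h) = J (y t)).
{ intro t; apply R3_ext_dot; intro n; unfold J, k.
  rewrite dot_plus_r, dot_minus_r, !dot_turn_transpose.
  set (n' := turn e C (- S) n).
  pose proof (is_derive_zero_const (fun t => dot n (y (t + h)) - dot n' (y t))) as Hcst.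
  cut (dot n (y (t + h)) - dot n' (y t) = dot n (y (0 + h)) - dot n' (y 0)).
  { rewrite Rplus_0_l; lra. }
  apply Hcst; clear t Hcst; intro t.
  pose proof (is_derive_shift _ h t _ (is_derive_dot_const n y _ _ (Hy (t + h)))) as H1.
  pose proof (is_derive_dot_const n' y _ _ (Hy t)) as H2.
  pose proof (is_derive_minus _ _ _ _ _ H1 H2) as H.
  match type of H with is_derive _ _ ?l => replace 0 with l; [exact H|] end.
  rewrite !dot_scal_r; unfold n'; rewrite <- dot_turn_transpose, Hturn.
  replace (dot A (u (t + h))) with (- dot A (u t)) by (symmetry; apply Hanti).
  match goal with |- minus ?a ?b = _ => change (a - b = 0) end; r3_ring. }
assert (HJx : forall t, x' (t + h) = J (x t)).
{ intro t; rewrite (front_eq x y t); unfold J; rewrite turn_plus.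
  fold u; rewrite Hturn.
  transitivity (plus (y (t + h)) (opp (u (t + h))) : R3).
  - unfold x', bicycle_correspondence; cbn [fst snd].
    unfold u, frame; r3_ring.
  - rewrite HJy; unfold J; r3_ring. }
destruct HM as (HMiso & _ & HMxy).
assert (HJJx : forall t, J (J (x t)) = M (x t)).
{ intro t; rewrite <- HJx, <- (proj1 (HMxy t)).
  replace (t + T) with (t + h + h) by (unfold h; field).
  transitivity (plus (J (y (t + h))) (opp (turn e C S (u (t + h)))) : R3).
  - replace (x' (t + h)) with (minus (y (t + h)) (u (t + h)) : R3).
    + unfold J; rewrite turn_minus; r3_ring.
    + unfold x', bicycle_correspondence; cbn [fst snd]; unfold u, frame; r3_ring.
  - rewrite <- HJy, Hturn, (front_eq x y (t + h + h)); fold u; r3_ring. }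
destruct (turn_translation_screw e C S k He HCS) as (c & e' & Hscrew).
fold J in Hscrew.
pose proof (screw_motion_isometry c e' J Hscrew) as HJiso.
assert (HJJ : forall p, J (J p) = M p).
{ apply (isometries_agree (fun p => J (J p)) M x).
  - intros p q; cbv beta; now rewrite !HJiso.
  - exact HMiso.
  - intros (n & d & Hn & Hd); apply Hnonplanar; exists n, d; split; [exact Hn|].
    intro t; rewrite <- (Hd (t - T)), <- (proj1 (HMxy (t - T))).
    do 2 f_equal; ring.
  - exact HJJx. }
exists J; split; [|split].
- exists c, e'; split; [exact Hscrew|].
  now apply screw_motion_square with J.
- intro t; split; [apply HJx|apply HJy].
- exact HJJ.
Qed.
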